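(* Let $d\ge 2$. Every linearly repetitive Delone set $X$ in $\mathbb{R}^d$ is bi-Lipschitz equivalent to $\mathbb{Z}^d$.
   Context: $\mathbb{R}^d$ carries the Euclidean distance, and $B(x,r)$ is the closed ball of radius $r$ around $x$. A set $X\subset\mathbb{R}^d$ is a Delone set if there exist $r_0,R_0>0$ such that each ball of radius $R_0$ contains at least one point of $X$ and each ball of radius $r_0$ contains at most one point of $X$. Two Delone sets $X_1,X_2$ in $\mathbb{R}^d$ are bi-Lipschitz equivalent if there are a homeomorphism (in particular a bijection) $\phi:X_1\to X_2$ and a constant $K>0$ with $\frac1K\|x-x'\|\le\|\phi(x)-\phi(x')\|\le K\|x-x'\|$ for all $x,x'\in X_1$. A Delone set $X$ is repetitive if for each $r>0$ there is $M>0$ such that for each $z\in\mathbb{R}^d$ and each $x\in X$ there exists $y\in X\cap B(z,M)$ with $X\cap B(y,r)=(X\cap B(x,r))+y-x$. The smallest such $M$ is denoted $M_X(r)$. $X$ is linearly repetitive if it is repetitive and there exists $L>0$ such that $M_X(r)\le Lr$ for all $r\ge 1$. *)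

(* Defs.v *)
From HB Require Import structures.
From mathcomp Require Import all_boot all_order all_algebra.
From mathcomp Require Import all_classical all_reals all_analysis.

Set Implicit Arguments.
Unset Strict Implicit.
Unset Printing Implicit Defensive.

Import Order.TTheory GRing.Theory Num.Theory.
Import numFieldNormedType.Exports.

Local Open Scope classical_set_scope.
Local Open Scope ring_scope.

(* The norm `|x| that MathComp-Analysis puts on 'rV[R]_d is the sup norm, so
   the Euclidean norm and its closed balls are defined here. The topology
   on 'rV[R]_d is the same for both norms. *)
Definition enorm (R : realType) (d : nat) (x : 'rV[R]_d) : R :=
  Num.sqrt (\sum_(i < d) x ord0 i ^+ 2).

Definition eball (R : realType) (d : nat) (x : 'rV[R]_d) (r : R) :
    set 'rV[R]_d :=
  [set y | enorm (y - x) <= r].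

Definition delone (R : realType) (d : nat) (X : set 'rV[R]_d) : Prop :=
  exists r0 R0 : R,
    [/\ 0 < r0, 0 < R0,
        forall c, exists x, X x /\ eball c R0 x
      & forall c x y, X x -> X y -> eball c r0 x -> eball c r0 y -> x = y].

Definition repeats_within (R : realType) (d : nat) (X : set 'rV[R]_d)
    (r M : R) : Prop :=
  forall z x, X x ->
    exists y, [/\ X y, eball z M y
      & X `&` eball y r = [set p + y - x | p in X `&` eball x r]].

Definition repetitive (R : realType) (d : nat) (X : set 'rV[R]_d) : Prop :=
  forall r : R, 0 < r -> exists M : R, 0 < M /\ repeats_within X r M.

(* M_X(r). For a repetitive Delone set in positive dimension the infimum is a
   minimum: X is locally finite, so for every z and x the nearest suitable y
   exists. The value of inf on the empty set is junk, hence the repetitivity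
   clause in linearly_repetitive. *)
Definition repetitivity_function (R : realType) (d : nat)
    (X : set 'rV[R]_d) (r : R) : R :=
  inf [set M : R | 0 < M /\ repeats_within X r M].

Definition linearly_repetitive (R : realType) (d : nat)
    (X : set 'rV[R]_d) : Prop :=
  repetitive X /\
  exists L : R, 0 < L /\
    forall r : R, 1 <= r -> repetitivity_function X r <= L * r.

(* Maps between subsets are restrictions of maps of the ambient spaces; values
   outside the subsets play no role. *)
Definition homeomorphism_on (S T : topologicalType) (A : set S) (B : set T)
    (f : S -> T) : Prop :=
  exists g : T -> S,
    [/\ forall x, A x -> B (f x) /\ g (f x) = x,
        forall y, B y -> A (g y) /\ f (g y) = y,
        {within A, continuous f}
      & {within B, continuous g}].

Definition bilipschitz_equivalent (R : realType) (d : nat)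
    (X1 X2 : set 'rV[R]_d) : Prop :=
  exists (phi : 'rV[R]_d -> 'rV[R]_d) (K : R),
    [/\ homeomorphism_on X1 X2 phi, 0 < K
      & forall x x', X1 x -> X1 x' ->
          K^-1 * enorm (x - x') <= enorm (phi x - phi x') /\
          enorm (phi x - phi x') <= K * enorm (x - x')].

Definition integer_lattice (R : realType) (d : nat) : set 'rV[R]_d :=
  [set x | forall i, x ord0 i \is a Num.int].

(* Main.v *)
(* Proof. Counting points in boxes, linear repetitivity forces the density of
   boxes of side s to converge to some rho at a rate s^(-delta) (Lagarias and
   Pleasants). Put X on a fine grid and smooth its counting density by
   averaging f with its translate by s e_j, for j cyclic and s doubling. Two
   averagings at each scale make the density eps-close to rho with increments
   O(eps / s), where eps is the discrepancy at scale s. One averaging step is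
   realised by monotone rearrangement along the lines parallel to e_j, which
   moves points by O(s) but is (1 + O(eps))-bi-Lipschitz up to the mesh; as the
   eps are summable, the composition of all steps is bi-Lipschitz up to a
   constant. Everything is phrased with relations satisfying Hall's condition
   rather than maps, so that no change of variables is needed: the composed
   relation carries the points of X to unit cubes with multiplicity one. Hall's
   theorem gives injections in both directions, an ultrafilter limit over
   larger and larger windows makes them global, and Cantor-Bernstein merges
   them into a bijection. *)

Require Import Defs.
From HB Require Import structures.
From mathcomp Require Import all_boot all_order all_algebra finmap.
From mathcomp Require Import all_classical all_reals all_analysis.
From mathcomp Require Import ring lra zify.

Set Implicit Arguments.
Unset Strict Implicit.
Unset Printing Implicit Defensive.

Import Order.TTheory GRing.Theory Num.Theory.
Import numFieldNormedType.Exports.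
Local Open Scope ring_scope.

(** * Weighted Hall conditions *)

(** The number of steps grows with the window, while the final constants must not. The
    multiplicative errors are summable, but each averaging step also loses a fixed number of cells.
    Lengths are therefore measured in cells of side [lam / T] with [T] at least the number of fine
    steps, so that the total loss is O(1) in length. Scales below [lam], where the counts are not
    yet equidistributed, need no care for the same reason: displacements of O([T]) cells are an O(1)
    error. The two averagings at each scale do different jobs. The first makes the density eps-close
    to its mean; the second turns this closeness into increments eps / s. Displacements of order s
    then vary by s times eps / s per cell, which is the distortion eps. After the last scale a
    defect eps remains. It is removed by one rearrangement against the constant density, whose
    distortion is controlled only within about s cells of a chosen hyperplane; this is what forces
    the windows and the passage to a limit. *)

Definition image_finite (S T : eqType) (E : S -> T -> Prop) : Prop :=
  forall p, exists s : seq T, forall q, E p q -> q \in s.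

Definition dominates (R : realType) (S T : eqType) (E : S -> T -> Prop)
    (f : S -> R) (g : T -> R) : Prop :=
  forall (A : seq S) (B : seq T), uniq A -> uniq B ->
    (forall p q, p \in A -> E p q -> q \in B) ->
    \sum_(p <- A) f p <= \sum_(q <- B) g q.

(* Weighted form of Hall's condition in both directions; it holds as soon as a
   coupling of [f] and [g] is supported by [E]. *)
Definition transport (R : realType) (S T : eqType) (E : S -> T -> Prop)
    (f : S -> R) (g : T -> R) : Prop :=
  [/\ image_finite E, image_finite (fun q p => E p q),
      dominates E f g & dominates (fun q p => E p q) g f].

Definition rcomp (S T U : Type) (E : S -> T -> Prop) (E' : T -> U -> Prop) :
    S -> U -> Prop :=
  fun p r => exists2 q, E p q & E' q r.

Lemma image_finite_seq (S T : eqType) (E : S -> T -> Prop) (A : seq S) :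
  image_finite E ->
  exists2 s : seq T, uniq s &
    forall q, (q \in s) <-> (exists2 p, p \in A & E p q).
Proof.
move=> Efin.
suff [s hs] : exists s : seq T, forall p q, p \in A -> E p q -> q \in s.
  exists (undup [seq q <- s | `[< exists2 p, p \in A & E p q >]]).
    exact: undup_uniq.
  move=> q; rewrite mem_undup mem_filter; split.
    by move=> /andP[/asboolP].
  move=> h; rewrite asboolT //=; have [p pA pq] := h.
  exact: hs pA pq.
elim: A => [|a A [s hs]]; first by exists [::].
have [t ht] := Efin a; exists (t ++ s) => p q.
rewrite inE mem_cat => /orP[/eqP-> /ht->//|pA pq].
by rewrite (hs _ _ pA pq) orbT.
Qed.

Lemma image_finite_comp (S T U : eqType) (E : S -> T -> Prop)
    (E' : T -> U -> Prop) :
  image_finite E -> image_finite E' -> image_finite (rcomp E E').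
Proof.
move=> h h' p; have [s _ hs] := image_finite_seq [:: p] h.
have [t _ ht] := image_finite_seq s h'; exists t => r [q pq qr].
by apply/ht; exists q => //; apply/hs; exists p => //; rewrite inE.
Qed.

(** The intermediate set is the exact image of [A], which is finite. Hall conditions thus compose
    without any gluing of couplings. *)
Lemma dominates_comp (R : realType) (S T U : eqType) (E : S -> T -> Prop)
    (E' : T -> U -> Prop) (f : S -> R) (g : T -> R) (h : U -> R) :
  image_finite E -> dominates E f g -> dominates E' g h ->
  dominates (rcomp E E') f h.
Proof.
move=> fin dfg dgh A C uA uC AC; have [B uB hB] := image_finite_seq A fin.
apply: (@le_trans _ _ (\sum_(q <- B) g q)).
  by apply: dfg => // p q pA pq; apply/hB; exists p.
apply: dgh => // q r /hB[p pA pq] qr; apply: AC pA _.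
by exists q.
Qed.

Lemma transport_comp (R : realType) (S T U : eqType) (E : S -> T -> Prop)
    (E' : T -> U -> Prop) (f : S -> R) (g : T -> R) (h : U -> R) :
  transport E f g -> transport E' g h -> transport (rcomp E E') f h.
Proof.
move=> [e1 e2 e3 e4] [e1' e2' e3' e4']; split.
- exact: image_finite_comp.
- move=> r; have [s hs] := image_finite_comp e2' e2 r; exists s => p [q pq qr].
  by apply: hs; exists q.
- exact: dominates_comp e3 e3'.
- move=> A B uA uB AB; apply: (dominates_comp e2' e4' e4) => //.
  by move=> r p rA [q rq qp]; apply: AB rA _; exists q.
Qed.

(** Double counting: all mass leaving [A] lands in [B], and no point of [B] receives more than [g]
    allows. *)
Lemma coupling_dominates (R : realType) (S T : eqType) (E : S -> T -> Prop)
    (w : S -> T -> R) (f : S -> R) (g : T -> R) :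
  (forall p (B : seq T), uniq B -> (forall q, E p q -> q \in B) ->
     f p <= \sum_(q <- B) w p q) ->
  (forall q (A : seq S), uniq A -> \sum_(p <- A) w p q <= g q) ->
  dominates E f g.
Proof.
move=> hf hg A B uA uB AB.
apply: (@le_trans _ _ (\sum_(p <- A) \sum_(q <- B) w p q)).
  rewrite big_seq [leRHS]big_seq; apply: ler_sum => p pA.
  by apply: hf => // q; apply: AB.
by rewrite exchange_big /=; apply: ler_sum => q _; apply: hg.
Qed.

(** * Monotone rearrangement along lines *)

Lemma coupling_transport (R : realType) (S T : eqType)
    (w : S -> T -> R) (f : S -> R) (g : T -> R) :
  (forall p q, 0 <= w p q) ->
  (forall p, exists s : seq T, [/\ uniq s, forall q, 0 < w p q -> q \in s
     & \sum_(q <- s) w p q = f p]) ->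
  (forall q, exists s : seq S, [/\ uniq s, forall p, 0 < w p q -> p \in s
     & \sum_(p <- s) w p q = g q]) ->
  transport (fun p q => 0 < w p q) f g.
Proof.
have sum_le (I : eqType) (F : I -> R) (A s : seq I) : (forall i, 0 <= F i) ->
    uniq A -> uniq s -> (forall i, 0 < F i -> i \in s) ->
    \sum_(i <- A) F i <= \sum_(i <- s) F i.
  move=> F0 uA us As; rewrite (bigID (fun i => i \in s)) /= addrC big1 ?add0r.
    rewrite -big_filter (perm_big [seq i <- s | i \in A]) /=.
      by rewrite big_filter [leRHS](bigID (mem A)) /= lerDl sumr_ge0.
    apply: uniq_perm; rewrite ?filter_uniq// => i.
    by rewrite !mem_filter andbC.
  move=> i nis; apply/eqP; rewrite eq_le F0 andbT leNgt.
  by apply: contra nis; apply: As.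
move=> w0 row col; split.
- by move=> p; have [s [_ h _]] := row p; exists s.
- by move=> q; have [s [_ h _]] := col q; exists s.
- apply: (coupling_dominates (w := w)).
    by move=> p B uB hB; have [s [us hs <-]] := row p; apply: sum_le.
  by move=> q A uA; have [s [us hs <-]] := col q; apply: sum_le.
- apply: (coupling_dominates (w := fun q p => w p q)).
    by move=> q B uB hB; have [s [us hs <-]] := col q; apply: sum_le.
  by move=> p A uA; have [s [us hs <-]] := row p; apply: sum_le.
Qed.

Definition evec (d : nat) (j : 'I_d) : 'rV[int]_d := delta_mx ord0 j.

Lemma line_growth (R : realType) (d : nat) (j : 'I_d) (F : 'rV[int]_d -> R)
    (lo : R) (p : 'rV[int]_d) (u v : int) :
  (forall q, lo <= F q - F (q - evec j)) -> u <= v ->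
  lo * (v - u)%:~R <= F (p + v *: evec j) - F (p + u *: evec j).
Proof.
move=> h uv; have -> : v = u + `|v - u|%N%:Z by rewrite gez0_abs ?subr_ge0//;
  lra.
rewrite addrAC subrr add0r; elim: `|v - u|%N => [|n].
  by rewrite addr0 subrr !mulr0.
have -> : p + (u + n.+1%:Z) *: evec j = p + (u + n%:Z) *: evec j + evec j.
  by rewrite intS [1 + _]addrC addrA [in LHS]scalerDl scale1r addrA.
have := h (p + (u + n%:Z) *: evec j + evec j).
rewrite addrK [n.+1%:Z]intS intrD; lra.
Qed.

Definition overlap (R : realType) (a b c d : R) : R :=
  Num.max 0 (Num.min b d - Num.max a c).

Lemma overlapC (R : realType) (a b c d : R) :
  overlap a b c d = overlap c d a b.
Proof. by rewrite /overlap minC (maxC a). Qed.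

(** The right-hand side is an increment of the map that clamps its argument to the interval from [a]
    to [b], so overlaps with consecutive intervals telescope. *)
Lemma overlapE (R : realType) (a b c d : R) : a <= b -> c <= d ->
  overlap a b c d = Num.max a (Num.min b d) - Num.max a (Num.min b c).
Proof.
move=> ab cd; rewrite /overlap.
case: (lerP b d) => h1; case: (lerP a c) => h2;
case: (lerP b c) => h3; repeat case: lerP => ?; lra.
Qed.

Lemma overlap_gt0 (R : realType) (a b c d : R) :
  0 < overlap a b c d -> a < d /\ c < b.
Proof.
rewrite /overlap lt_max ltxx /= subr_gt0 lt_min !gt_max.
by move=> /andP[/andP[_ ->] /andP[-> _]].
Qed.

(* Monotone rearrangement along the lines parallel to the [j]-th axis: [F] and
   [G] are cumulative functions, and a cell carries the interval between its
   two consecutive values. *)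
Definition line_weight (R : realType) (d : nat) (j : 'I_d)
    (F G : 'rV[int]_d -> R) (p q : 'rV[int]_d) : R :=
  if q - p == (q - p) ord0 j *: evec j
  then overlap (F (p - evec j)) (F p) (G (q - evec j)) (G q) else 0.

Lemma line_weightC (R : realType) (d : nat) (j : 'I_d)
    (F G : 'rV[int]_d -> R) (p q : 'rV[int]_d) :
  line_weight j F G p q = line_weight j G F q p.
Proof.
rewrite /line_weight overlapC -(opprB q p) [(- (q - p)) _ _]mxE scaleNr eqr_opp.
by [].
Qed.

Lemma line_weight_row (R : realType) (d : nat) (j : 'I_d)
    (F G : 'rV[int]_d -> R) (lo : R) (p : 'rV[int]_d) : 0 < lo ->
  (forall q, lo <= F q - F (q - evec j)) ->
  (forall q, lo <= G q - G (q - evec j)) ->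
  exists s, [/\ uniq s, forall q, 0 < line_weight j F G p q -> q \in s
    & \sum_(q <- s) line_weight j F G p q = F p - F (p - evec j)].
Proof.
move=> lo0 hF hG.
have mono (u v : int) := @line_growth R d j G lo p u v hG.
pose e := evec j.
have monoP (n : nat) : G p + lo * n%:R <= G (p + n%:Z *: e).
  by have := mono 0 n%:Z isT; rewrite subr0 scale0r addr0 lerBrDl -pmulrn.
have monoN (n : nat) : G (p + (- n%:Z) *: e) <= G p - lo * n%:R.
  have := mono (- n%:Z) 0;
    rewrite oppr_le0 sub0r opprK scale0r addr0 => /(_ isT).
  by rewrite -pmulrn lerBrDl -lerBrDr.
(* Growth by at least [lo] per cell makes [G] leave the interval of [p] after finitely many cells.
   The cells used run from [p - N e] to [p + (N - 1) e]; the interval of a cell [q] begins at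
   [G (q - e)], hence [N + 1] on the lower side. *)
have [N [N0 N1]] : exists N : nat, G (p + (- N.+1%:Z) *: e) <= F (p - e) /\
    F p <= G (p + (N%:Z - 1) *: e).
  pose x := (`|F p - G p| + `|F (p - e) - G p|) / lo.
  have x0 : 0 <= x by rewrite divr_ge0 ?addr_ge0// ltW.
  have := archi_boundP x0; set n := Num.bound x => xn.
  have {}xn : `|F p - G p| + `|F (p - e) - G p| <= lo * n%:R.
    by rewrite mulrC -ler_pdivrMr// ltW.
  have n1 := ler_norm (F p - G p); have n2 := ler_norm (G p - F (p - e)).
  have m1 := normr_ge0 (F p - G p); have m2 := normr_ge0 (F (p - e) - G p).
  rewrite distrC in n2; exists n.+1; split.
    by apply: le_trans (monoN _) _; rewrite -[n.+2]addn2 natrD; nra.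
  have -> : n.+1%:Z - 1 = n%:Z by lia.
  by apply: le_trans (monoP _); lra.
pose q_ (k : nat) := p + (k%:Z - N%:Z) *: e.
have qj k : (q_ k - p) ord0 j = k%:Z - N%:Z.
  by rewrite /q_ addrAC subrr add0r !mxE !eqxx mulr1.
have wq k : line_weight j F G p (q_ k) = overlap (F (p - e)) (F p)
    (G (p + (k%:Z - N%:Z - 1) *: e)) (G (q_ k)).
  rewrite /line_weight qj {1}/q_ addrAC subrr add0r eqxx.
  by rewrite /q_ -addrA -{2}(scale1r (evec j)) -scalerBl.
exists [seq q_ k | k <- iota 0 (N + N)]; split.
- rewrite map_inj_uniq ?iota_uniq// => k l /(congr1 (fun q => (q - p) ord0 j)).
  by rewrite !qj => /addIr [].
- move=> q; rewrite /line_weight; case: ifPn; last by rewrite ltxx.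
  set v := (q - p) ord0 j => /eqP qv /overlap_gt0.
  have {qv}-> : q = p + v *: e by rewrite -qv addrC subrK.
  rewrite -addrA -{2}(scale1r (evec j)) -scalerBl.
  move=> [h1 h2].
  have v1 : - N%:Z <= v.
    rewrite leNgt; apply/negP => vN.
    have : v <= - N.+1%:Z by lia.
    move=> /mono; have : 0 <= (- N.+1%:Z - v)%:~R :> R by rewrite ler0z; lia.
    nra.
  have v2 : v < N%:Z.
    rewrite ltNge; apply/negP => vN.
    have : N%:Z - 1 <= v - 1 by lia.
    move=> /mono; have : 0 <= (v - 1 - (N%:Z - 1))%:~R :> R by rewrite ler0z;
      lia.
    nra.
  apply/mapP; exists `|(v + N%:Z)%R|%N; first by rewrite mem_iota; lia.
  by rewrite /q_; congr (_ + _ *: _); lia.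
rewrite big_map.
have Fp : F (p - e) <= F p by have := hF p; rewrite -/e; lra.
pose H k := Num.max (F (p - e)) (Num.min (F p) (G (p + (k%:Z - N%:Z - 1) *:
  e))).
rewrite (eq_bigr (fun k => H k.+1 - H k)) => [|k _]; last first.
  rewrite wq overlapE//; last first.
    have /mono : k%:Z - N%:Z - 1 <= k%:Z - N%:Z by lia.
    have -> : k%:Z - N%:Z - (k%:Z - N%:Z - 1) = 1 by lia.
    by rewrite mulr1 -/(q_ k); lra.
  by rewrite /H /q_; have -> : k.+1%:Z - N%:Z - 1 = k%:Z - N%:Z by lia.
have -> : iota 0 (N + N) = index_iota 0 (N + N) by rewrite /index_iota subn0.
rewrite telescope_sumr// /H; congr (_ - _).
  have -> : (N + N)%N%:Z - N%:Z - 1 = N%:Z - 1 by lia.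
  by rewrite min_l// max_r.
have -> : 0%N%:Z - N%:Z - 1 = - N.+1%:Z by lia.
by rewrite min_r ?max_l//; lra.
Qed.

Lemma line_weight_transport (R : realType) (d : nat) (j : 'I_d)
    (F G : 'rV[int]_d -> R) (lo : R) : 0 < lo ->
  (forall q, lo <= F q - F (q - evec j)) ->
  (forall q, lo <= G q - G (q - evec j)) ->
  transport (fun p q => 0 < line_weight j F G p q)
    (fun q => F q - F (q - evec j)) (fun q => G q - G (q - evec j)).
Proof.
move=> lo0 hF hG; apply: coupling_transport.
- by move=> p q; rewrite /line_weight; case: ifP => // _; rewrite le_max lexx.
- by move=> p; exact: line_weight_row hG.
- move=> q; have [s [us hs <-]] := line_weight_row q lo0 hG hF; exists s.
  split=> // [p|]; first by rewrite line_weightC; apply: hs.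
  by apply: eq_bigr => p _; rewrite line_weightC.
Qed.

(** * Quasi-isometric relations *)

Definition l1 (R : numDomainType) (d : nat) (x : 'rV[R]_d) : R :=
  \sum_(i < d) `|x ord0 i|.

Lemma l1_ge0 (R : numDomainType) (d : nat) (x : 'rV[R]_d) : 0 <= l1 x.
Proof. by apply: sumr_ge0. Qed.

Lemma l1D (R : numDomainType) (d : nat) (x y : 'rV[R]_d) :
  l1 (x + y) <= l1 x + l1 y.
Proof. by rewrite -big_split; apply: ler_sum => i _; rewrite mxE ler_normD. Qed.

Lemma l1N (R : numDomainType) (d : nat) (x : 'rV[R]_d) : l1 (- x) = l1 x.
Proof. by apply: eq_bigr => i _; rewrite mxE normrN. Qed.

Lemma coord_le_l1 (R : numDomainType) (d : nat) (x : 'rV[R]_d) (i : 'I_d) :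
  `|x ord0 i| <= l1 x.
Proof. by rewrite /l1 (bigD1 i) //= lerDl sumr_ge0. Qed.

Lemma l1_scale_evec (d : nat) (v : int) (j : 'I_d) : l1 (v *: evec j) = `|v|.
Proof.
rewrite /l1 (bigD1 j) //= !mxE !eqxx mulr1 big1 ?addr0// => i ij.
by rewrite !mxE eqxx (negPf ij) mulr0 normr0.
Qed.

Definition dist1 (R : realType) (d : nat) (p q : 'rV[int]_d) : R :=
  (l1 (p - q))%:~R.

Lemma dist1_ge0 (R : realType) (d : nat) (p q : 'rV[int]_d) :
  0 <= dist1 R p q.
Proof. by rewrite ler0z l1_ge0. Qed.

Lemma dist1_shift (R : realType) (d : nat) (j : 'I_d) (p p' : 'rV[int]_d)
    (v v' : int) :
  dist1 R (p + v *: evec j) (p' + v' *: evec j)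
    <= dist1 R p p' + `|v - v'|%:~R.
Proof.
rewrite /dist1 -intrD ler_int -(l1_scale_evec _ j); apply: le_trans (l1D _ _).
by rewrite scalerBl opprD addrACA.
Qed.

Lemma line_lipschitz (R : realType) (d : nat) (j : 'I_d)
    (F : 'rV[int]_d -> R) (b : R) (p : 'rV[int]_d) (u v : int) :
  (forall q, `|F q - F (q - evec j)| <= b) ->
  `|F (p + v *: evec j) - F (p + u *: evec j)| <= b * `|v - u|%:~R.
Proof.
move=> h.
suff {u v} H (u v : int) : u <= v ->
    `|F (p + v *: evec j) - F (p + u *: evec j)| <= b * (v - u)%:~R.
  case: (lerP u v) => uv; first exact: H.
  by rewrite distrC; apply: H; apply: ltW.
move=> uv; rewrite ler_norml; apply/andP; split.
  have := @line_growth R d j F (- b) p u v; rewrite mulNr; apply=> // q.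
  by have := h q; rewrite ler_norml => /andP[].
have := @line_growth R d j (fun q => - F q) (- b) p u v.
rewrite mulNr -opprD lerN2; apply=> // q.
by rewrite -opprD lerN2; have := h q; rewrite ler_norml => /andP[].
Qed.

Lemma lipschitz_dist1 (R : realType) (d : nat) (f : 'rV[int]_d -> R) (l : R) :
  (forall i q, `|f q - f (q - evec i)| <= l) ->
  forall p p', `|f p - f p'| <= l * dist1 R p p'.
Proof.
move=> h p p'; rewrite /dist1.
have {1}-> : p = p' + \sum_(i < d) (p - p') ord0 i *: evec i.
  by rewrite -row_sum_delta addrC subrK.
rewrite /l1.
apply: (big_rec2 (fun y1 y2 => `|f (p' + y1) - f p'| <= l * y2%:~R)).
  by rewrite addr0 subrr normr0 mulr0.
move=> i y1 y2 _ IH.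
have -> : f (p' + ((p - p') ord0 i *: delta_mx 0 i + y1)) - f p' =
  (f (p' + y1 + (p - p') ord0 i *: evec i) - f (p' + y1 + 0 *: evec i))
   + (f (p' + y1) - f p').
  rewrite scale0r addr0 addrACA addrA addrK; congr (f _ - _).
  by rewrite addrAC addrA.
apply: le_trans (ler_normD _ _) _; rewrite intrD mulrDr lerD//.
by have := @line_lipschitz R d i f l (p' + y1) 0 ((p - p') ord0 i) (h i);
  rewrite subr0.
Qed.

(** [C] stands inside the bracket so that, for factors at least 1, composition multiplies the [K]
    but only adds the [C]. *)
Definition quasi_isometric (R : realType) (S T : Type) (dS : S -> S -> R)
    (dT : T -> T -> R) (E : S -> T -> Prop) (K C : R) : Prop :=
  forall p q p' q', E p q -> E p' q' ->
    dT q q' <= K * (dS p p' + C) /\ dS p p' <= K * (dT q q' + C).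

Lemma quasi_isometric_comp (R : realType) (S T U : Type) (dS : S -> S -> R)
    (dT : T -> T -> R) (dU : U -> U -> R) (E : S -> T -> Prop)
    (E' : T -> U -> Prop) (K K' C C' : R) :
  1 <= K -> 1 <= K' -> 0 <= C -> 0 <= C' ->
  quasi_isometric dS dT E K C -> quasi_isometric dT dU E' K' C' ->
  quasi_isometric dS dU (rcomp E E') (K * K') (C + C').
Proof.
move=> K1 K1' C0 C0' h h' p r p' r' [q pq qr] [q' pq' qr'].
have [a b] := h _ _ _ _ pq pq'; have [a' b'] := h' _ _ _ _ qr qr'; split.
  apply: (le_trans a'); rewrite [K * _]mulrC -mulrA ler_wpM2l//; nra.
apply: (le_trans b); rewrite -mulrA ler_wpM2l//; nra.
Qed.

(** Each line is summed from the hyperplane of height [c], with a minus sign below it; [r p] is the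
    foot of [p] on that hyperplane. *)
Lemma cumulative_exists (R : realType) (d : nat) (j : 'I_d)
    (f : 'rV[int]_d -> R) (c : int) :
  exists F : 'rV[int]_d -> R,
    (forall p, F p - F (p - evec j) = f p) /\
    (forall p : 'rV[int]_d, p ord0 j = c -> F p = 0).
Proof.
pose r (p : 'rV[int]_d) := p + (c - p ord0 j) *: evec j.
exists (fun p : 'rV[int]_d => match p ord0 j - c with
  | Posz n => \sum_(k < n) f (r p + k.+1%:Z *: evec j)
  | Negz n => - \sum_(k < n.+1) f (r p - k%:Z *: evec j) end); split;
    last first.
  by move=> p ->; rewrite subrr; apply: big_ord0.
move=> p.
have jE : (p - evec j) ord0 j = p ord0 j - 1 by rewrite !mxE !eqxx.
have rE : r (p - evec j) = r p.
  rewrite /r jE; have -> : c - (p ord0 j - 1) = c - p ord0 j + 1 by lia.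
  by rewrite scalerDl scale1r addrACA addNr addr0.
have pE : p = r p + (p ord0 j - c) *: evec j.
  rewrite /r -addrA -scalerDl.
  have -> : c - p ord0 j + (p ord0 j - c) = 0 by lia.
  by rewrite scale0r addr0.
rewrite rE jE [X in _ = f X]pE addrAC; case: (p ord0 j - c) => [[|n]|n].
- have -> : 0%Z - 1 = Negz 0 by lia.
  by rewrite opprK big_ord1 big_ord0 add0r !scale0r subr0 addr0.
- have -> : n.+1%:Z - 1 = n%:Z by lia.
  by rewrite big_ord_recr /= addrAC subrr add0r.
- have -> : Negz n - 1 = Negz n.+1 by lia.
  by rewrite opprK [X in _ + X]big_ord_recr /= addKr NegzE scaleNr.
Qed.

Lemma line_weight_gt0 (R : realType) (d : nat) (j : 'I_d)
    (F G : 'rV[int]_d -> R) (p q : 'rV[int]_d) :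
  0 < line_weight j F G p q ->
  [/\ q = p + (q - p) ord0 j *: evec j, F (p - evec j) < G q
    & G (q - evec j) < F p].
Proof.
rewrite /line_weight; case: ifPn; last by rewrite ltxx.
move=> /eqP h /overlap_gt0[h1 h2]; split=> //.
by rewrite -h addrC subrK.
Qed.

(** Coupled cells have overlapping intervals, so [F p] and [G q] differ by at most 3 / 2, and so do
    [F p'] and [G q']: together this is the 3. Carrying the displacement of [p'] over to the line of
    [p] costs [S * b], because the increments of [G] on the two lines differ by at most [b] per
    cell. The factor 2 inverts the slope of [G], which is at least 1 / 2. *)
Lemma line_displacement_diff (R : realType) (d : nat) (j : 'I_d)
    (F G : 'rV[int]_d -> R) (a b S : R) (p q p' q' : 'rV[int]_d) :
  (forall r, F r - F (r - evec j) <= 3 / 2) ->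
  (forall r, 1 / 2 <= G r - G (r - evec j) <= 3 / 2) ->
  (forall r, `|(G r - G (r - evec j))
               - (G (r + (p' - p)) - G (r + (p' - p) - evec j))| <= b) ->
  0 <= b ->
  `|(F p - G p) - (F p' - G p')| <= a ->
  0 < line_weight j F G p q -> 0 < line_weight j F G p' q' ->
  `|(q' - p') ord0 j|%:~R <= S ->
  `|(q - p) ord0 j - (q' - p') ord0 j|%:~R <= 2 * (a + 3 + S * b).
Proof.
move=> hF hG hb b0 ha /line_weight_gt0[qE pq1 pq2].
move=> /line_weight_gt0[qE' pq1' pq2'].
move: ((q - p) ord0 j) ((q' - p') ord0 j) qE qE' => v v' qE qE' vS.
have := hF p; have := hF p'; have := hG q; have := hG q' => g1 g2 g3 g4.
have h1 : `|(G (p + v' *: evec j) - G (p' + v' *: evec j)) - (G p - G p')|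
    <= S * b.
  have := @line_lipschitz R d j (fun r => G r - G (r + (p' - p))) b p 0 v'.
  rewrite scale0r addr0 subr0.
  have -> : p + v' *: evec j + (p' - p) = p' + v' *: evec j.
    by rewrite addrAC subrKC.
  rewrite subrKC => h; apply: le_trans (h _) _; last by rewrite mulrC ler_wpM2r.
  move=> r; rewrite [r - _ + _]addrAC; apply: le_trans (hb r).
  by rewrite le_eqVlt; apply/orP; left; apply/eqP; congr (`|_|); ring.
have h2 (u w : int) : u <= w ->
    1 / 2 * (w - u)%:~R <= G (p + w *: evec j) - G (p + u *: evec j).
  by apply: line_growth => r; have /andP[] := hG r.
have h3 : `|v - v'|%:~R <= 2 * `|G (p + v *: evec j) - G (p + v' *: evec j)|.
  case: (lerP v' v) => vv.
    have := h2 _ _ vv;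
      have := ler_norm (G (p + v *: evec j) - G (p + v' *: evec j)).
    lra.
  rewrite [ `|G _ - _| ]distrC.
  have := h2 _ _ (ltW vv);
    have := ler_norm (G (p + v' *: evec j) - G (p + v *: evec j)).
  lra.
apply: (le_trans h3); rewrite -qE.
suff : `|G q - G (p + v' *: evec j)| <= a + 3 + S * b by lra.
move: h1 ha; rewrite -qE' !ler_norml => /andP[? ?] /andP[? ?].
by apply/andP; split; lra.
Qed.

Lemma line_displacement_le (R : realType) (d : nat) (j : 'I_d)
    (F G : 'rV[int]_d -> R) (p q : 'rV[int]_d) :
  (forall r, F r - F (r - evec j) <= 3 / 2) ->
  (forall r, 1 / 2 <= G r - G (r - evec j) <= 3 / 2) ->
  0 < line_weight j F G p q ->
  `|(q - p) ord0 j|%:~R <= 3 + 2 * `|F p - G p|.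
Proof.
move=> hF hG /line_weight_gt0[].
move: ((q - p) ord0 j) => v qE pq1 pq2.
have := hF p; have := hG q => g1 g2.
have h2 (u w : int) : u <= w ->
    1 / 2 * (w - u)%:~R <= G (p + w *: evec j) - G (p + u *: evec j).
  by apply: line_growth => r; have /andP[] := hG r.
have n1 := ler_norm (F p - G p); have n2 := ler_norm (G p - F p).
rewrite distrC in n2.
case: (lerP 0 v) => v0.
  by have := h2 _ _ v0; rewrite (ger0_norm v0) subr0 scale0r addr0 -qE; lra.
have := h2 _ _ (ltW v0); rewrite (ltr0_norm v0) sub0r scale0r addr0 -qE; lra.
Qed.

Lemma line_lipschitz_back (R : realType) (d : nat) (j : 'I_d)
    (F : 'rV[int]_d -> R) (b : R) (p : 'rV[int]_d) (n : nat) :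
  (forall q, `|F q - F (q - evec j)| <= b) ->
  `|F p - F (p - n%:Z *: evec j)| <= b * n%:R.
Proof.
move=> /(line_lipschitz p (- n%:Z) 0).
by rewrite scale0r addr0 scaleNr sub0r opprK.
Qed.

Definition avg (R : realType) (d : nat) (j : 'I_d) (s : nat)
    (f : 'rV[int]_d -> R) : 'rV[int]_d -> R :=
  fun p => (f p + f (p - s%:Z *: evec j)) / 2.

(** Both bounds are triangle inequalities; the second one is solved for [dist1 R p p'] by means of 1
    / (1 - a) <= 1 + 2 a, valid for a <= 1 / 2. *)
Lemma shift_dist1 (R : realType) (d : nat) (j : 'I_d)
    (p q p' q' : 'rV[int]_d) (a b : R) :
  0 <= a <= 1 / 2 -> 0 <= b ->
  q = p + (q - p) ord0 j *: evec j -> q' = p' + (q' - p') ord0 j *: evec j ->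
  `|(q - p) ord0 j - (q' - p') ord0 j|%:~R <= a * dist1 R p p' + b ->
  dist1 R q q' <= (1 + 2 * a) * (dist1 R p p' + 2 * b) /\
  dist1 R p p' <= (1 + 2 * a) * (dist1 R q q' + 2 * b).
Proof.
move=> /andP[a0 a1] b0.
move: ((q - p) ord0 j) ((q' - p') ord0 j) => v v' qE qE' vv.
have D0 := dist1_ge0 R p p'; have D0' := dist1_ge0 R q q'.
have h1 : dist1 R q q' <= dist1 R p p' + `|v - v'|%:~R.
  by rewrite qE qE'; exact: dist1_shift.
have h2 : dist1 R p p' <= dist1 R q q' + `|v - v'|%:~R.
  have -> : p = q + (- v) *: evec j by rewrite qE scaleNr addrK.
  have -> : p' = q' + (- v') *: evec j by rewrite qE' scaleNr addrK.
  by apply: le_trans (dist1_shift _ _ _ _ _ _) _; rewrite -opprD normrN.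
split; nra.
Qed.

Lemma shift_quasi_isometric (R : realType) (d : nat) (j : 'I_d)
    (E : 'rV[int]_d -> 'rV[int]_d -> Prop) (a b : R) :
  0 <= a <= 1 / 2 -> 0 <= b ->
  (forall p q, E p q -> q = p + (q - p) ord0 j *: evec j) ->
  (forall p q p' q', E p q -> E p' q' ->
     `|(q - p) ord0 j - (q' - p') ord0 j|%:~R <= a * dist1 R p p' + b) ->
  quasi_isometric (@dist1 R d) (@dist1 R d) E (1 + 2 * a) (2 * b).
Proof.
move=> a01 b0 hE h p q p' q' pq pq'; apply: (@shift_dist1 _ _ j) => //.
- exact: hE.
- exact: hE.
- exact: h.
Qed.

(** Every cell keeps half of its mass and sends the other half [s] cells along the axis, so
    distances change by an additive error only. This serves at small scales, where [f] may vanish on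
    many cells. *)
Lemma avg_transport_coarse (R : realType) (d : nat) (j : 'I_d) (s : nat)
    (f : 'rV[int]_d -> R) : (0 < s)%N -> (forall p, 0 <= f p) ->
  exists E, transport E f (avg j s f) /\
    quasi_isometric (@dist1 R d) (@dist1 R d) E 1 (2 * s%:R).
Proof.
move=> s0 f0; pose t := s%:Z *: evec j.
have t0 : t != 0.
  apply/eqP => /matrixP/(_ ord0 j); rewrite !mxE !eqxx mulr1.
  by case: s s0 @t.
have tne (p : 'rV[int]_d) : (p == p + t) = false.
  by rewrite -subr_eq0 opprD addrA subrr sub0r oppr_eq0 (negPf t0).
have tne' (p : 'rV[int]_d) : (p + t == p) = false by rewrite eq_sym.
pose w (p q : 'rV[int]_d) : R := f p / 2 * ((q == p)%:R + (q == p + t)%:R).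
have w_gt0 p q : 0 < w p q -> q = p + 0 *: evec j \/ q = p + t.
  rewrite /w scale0r addr0; case: eqP => [->|_]; first by left.
  by case: eqP => [->|_]; [right|rewrite addr0 mulr0 ltxx].
exists (fun p q => 0 < w p q); split.
  apply: coupling_transport.
  - by move=> p q; rewrite mulr_ge0 ?divr_ge0 ?addr_ge0.
  - move=> p; exists [:: p; p + t]; split=> /=.
    + by rewrite inE andbT tne.
    + by move=> q /w_gt0; rewrite !inE scale0r addr0 => -[]->;
      rewrite eqxx ?orbT.
    + by rewrite !big_cons big_nil /w !eqxx tne tne' /=; lra.
  - move=> q; exists [:: q; q - t]; split=> /=.
    + by rewrite inE andbT eq_sym subr_eq tne.
    + move=> p /w_gt0; rewrite !inE scale0r addr0.
      by move=> []->; rewrite ?addrK eqxx ?orbT.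
    + rewrite !big_cons big_nil /w /avg -/t subrK !eqxx tne.
      by rewrite [q == q - t]eq_sym subr_eq tne /=; lra.
have jE (u : int) (r : 'rV[int]_d) : (r + u *: evec j - r) ord0 j = u.
  by rewrite addrAC subrr add0r !mxE !eqxx mulr1.
have := @shift_quasi_isometric R d j (fun p q => 0 < w p q) 0 s%:R.
rewrite mulr0 addr0; apply.
- by rewrite lexx; lra.
- by [].
- by move=> p q /w_gt0[]->; rewrite /t jE.
move=> p q p' q'.
by move=> /w_gt0[]-> /w_gt0[]->; rewrite /t mul0r add0r !jE ?subrr ?subr0 ?sub0r
  ?normrN ?normr0 ?mulr0z// ger0_norm// pmulrn.
Qed.

Lemma avg_bounds (R : realType) (d : nat) (j : 'I_d) (s : nat)
    (f : 'rV[int]_d -> R) (lo hi : R) :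
  (forall p, lo <= f p <= hi) -> forall p, lo <= avg j s f p <= hi.
Proof.
move=> h p; have := h p; have := h (p - s%:Z *: evec j); rewrite /avg.
by move=> /andP[? ?] /andP[? ?]; apply/andP; split; lra.
Qed.

Lemma avg_lipschitz (R : realType) (d : nat) (j : 'I_d) (s : nat)
    (f : 'rV[int]_d -> R) (l : R) i :
  (forall p, `|f p - f (p - evec i)| <= l) ->
  forall p, `|avg j s f p - avg j s f (p - evec i)| <= l.
Proof.
move=> h p; have := h p; have := h (p - s%:Z *: evec j); rewrite /avg addrAC.
by rewrite !ler_norml => /andP[? ?] /andP[? ?]; apply/andP; split; lra.
Qed.

(* The cumulative functions of [f] and of its average differ by a sum over [s]
   cells of one line, which varies by at most [s * l] per cell transversally. *)
Lemma avg_transport (R : realType) (d : nat) (j : 'I_d) (s : nat)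
    (f : 'rV[int]_d -> R) (l : R) : (0 < s)%N -> 0 <= l ->
  (forall p, 1 / 2 <= f p <= 3 / 2) ->
  (forall i p, `|f p - f (p - evec i)| <= l) ->
  11 * (s%:R * l) <= 1 / 2 ->
  exists E, transport E f (avg j s f) /\
    quasi_isometric (@dist1 R d) (@dist1 R d) E (1 + 22 * (s%:R * l)) 12.
Proof.
move=> s0 l0 fb fl sl; have [F [Ff _]] := cumulative_exists j f 0.
pose G := avg j s F.
have Gg p : G p - G (p - evec j) = avg j s f p.
  by rewrite /G /avg -!Ff; rewrite [p - _ - _]addrAC; lra.
have gb := avg_bounds j s fb.
have gl i := avg_lipschitz j s (fl i).
have FG p : F p - G p = (F p - F (p - s%:Z *: evec j)) / 2.
  by rewrite /G /avg; lra.
exists (fun p q => 0 < line_weight j F G p q); split.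
  have -> : f = fun p => F p - F (p - evec j) by apply/funext => p; rewrite Ff.
  have -> : avg j s (fun p => F p - F (p - evec j))
      = fun p => G p - G (p - evec j).
    by apply/funext => p; rewrite Gg; congr (avg _ _ _ p); apply/funext => q;
      rewrite Ff.
  apply: (@line_weight_transport _ _ _ _ _ (1 / 2)); first by lra.
    by move=> q; rewrite Ff; have /andP[] := fb q.
  by move=> q; rewrite Gg; have /andP[] := gb q.
have -> : 22 * (s%:R * l) = 2 * (11 * (s%:R * l)) by ring.
have -> : 12 = 2 * 6 :> R by ring.
have sR : 1 <= s%:R :> R by rewrite ler1n.
apply: (@shift_quasi_isometric _ _ j).
- by apply/andP; split=> //; rewrite !mulr_ge0.
- by [].
- by move=> p q /line_weight_gt0[].
move=> p q p' q' pq pq'.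
have D0 := dist1_ge0 R p p'.
have lip (h : 'rV[int]_d -> R) : (forall i r, `|h r - h (r - evec i)| <= l) ->
    forall r, `|h r - h (r + (p' - p))| <= l * dist1 R p p'.
  move=> hl r; have := lipschitz_dist1 hl r (r + (p' - p)).
  have -> : dist1 R r (r + (p' - p)) = dist1 R p p'.
    by rewrite /dist1 opprD addrA subrr add0r opprB.
  by [].
(* [F] and [G] differ by half a sum of [s] values of [f], hence by at most 3 s / 4; the displacement
   is then at most 3 + 3 s / 2. *)
have disp : `|(q' - p') ord0 j|%:~R <= 5 * s%:R :> R.
  apply: (@le_trans _ _ (3 + 2 * `|F p' - G p'|)).
    apply: line_displacement_le pq'; first by move=> r; rewrite Ff;
      have /andP[] := fb r.
    by move=> r; rewrite Gg.
  rewrite FG.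
  rewrite normrM [ `|2^-1| ]gtr0_norm ?invr_gt0//.
  have : `|F p' - F (p' - s%:Z *: evec j)| <= 3 / 2 * s%:R.
    apply: line_lipschitz_back => r; rewrite Ff ger0_norm;
      have /andP[] := fb r; lra.
  lra.
have FFGG : `|(F p - G p) - (F p' - G p')| <= s%:R * (l * dist1 R p p') / 2.
  have H : `|F p - F p' - (F (p - s%:Z *: evec j) - F (p' - s%:Z *: evec j))|
      <= l * dist1 R p p' * s%:R.
    have pp (r : 'rV[int]_d) : p' - r = p - r + (p' - p).
      by rewrite addrAC subrKC.
    have := @line_lipschitz_back R d j (fun r => F r - F (r + (p' - p)))
      (l * dist1 R p p') p s.
    rewrite /= -pp subrKC; apply=> r; rewrite [r - _ + _]addrAC.
    apply: le_trans (lip _ fl r); rewrite -!Ff le_eqVlt; apply/orP; left.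
    by apply/eqP; congr (`|_|); ring.
  by move: H; rewrite !FG !ler_norml => /andP[? ?]; apply/andP; split; lra.
(* Writing D for the distance of [p] and [p'], the bound 2 (a + 3 + S b) with a = s l D / 2, b = l D
   and S = 5 s equals 11 s l D + 6. [shift_quasi_isometric] doubles both numbers. *)
apply: le_trans (line_displacement_diff _ _ _ _ FFGG pq pq' disp) _.
- by move=> r; rewrite Ff; have /andP[] := fb r.
- by move=> r; rewrite Gg.
- by move=> r; rewrite !Gg; apply: lip.
- by rewrite mulr_ge0.
- lra.
Qed.

(* [F] vanishes on the hyperplane of height [c], so its transversal variation is
   controlled near that hyperplane only. *)
Lemma flatten_transport (R : realType) (d : nat) (j : 'I_d) (c : int)
    (f : 'rV[int]_d -> R) (e l : R) : 0 <= l -> 6 * e <= 1 / 2 ->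
  (forall p, `|f p - 1| <= e) ->
  (forall i p, `|f p - f (p - evec i)| <= l) ->
  exists E : 'rV[int]_d -> 'rV[int]_d -> Prop, transport E f (fun=> 1) /\
    forall p q p' q', E p q -> E p' q' ->
      `|p' ord0 j - c|%:~R * l <= e ->
      dist1 R q q' <= (1 + 12 * e) * (dist1 R p p' + 12) /\
      dist1 R p p' <= (1 + 12 * e) * (dist1 R q q' + 12).
Proof.
move=> l0 e1 fe fl; have [F [Ff F0]] := cumulative_exists j f c.
have e0 : 0 <= e by apply: le_trans (fe 0).
pose G (q : 'rV[int]_d) : R := (q ord0 j - c)%:~R.
have Gg p : G p - G (p - evec j) = 1.
  rewrite /G -intrB !mxE !eqxx.
  by have -> : p ord0 j - c - (p ord0 j - 1 - c) = 1 by lia.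
have fb p : 1 / 2 <= f p <= 3 / 2.
  by have := fe p; rewrite ler_norml => /andP[? ?]; apply/andP; split; lra.
exists (fun p q => 0 < line_weight j F G p q); split.
  have -> : f = fun p => F p - F (p - evec j) by apply/funext => p; rewrite Ff.
  have -> : (fun=> 1) = fun p => G p - G (p - evec j).
    by apply/funext => p; rewrite Gg.
  apply: (@line_weight_transport _ _ _ _ _ (1 / 2)); first by lra.
    by move=> q; rewrite Ff; have /andP[] := fb q.
  by move=> q; rewrite Gg; lra.
move=> p q p' q' pq pq' win.
have -> : 12 * e = 2 * (6 * e) by ring.
have -> : 12 = 2 * 6 :> R by ring.
have D0 := dist1_ge0 R p p'.
have [qE _ _] := line_weight_gt0 pq; have [qE' _ _] := line_weight_gt0 pq'.
apply: (shift_dist1 (j := j)) => //; first by apply/andP; split=> //;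
  rewrite mulr_ge0.
have dj : `|p ord0 j - p' ord0 j|%:~R <= dist1 R p p'.
  by rewrite ler_int; have := coord_le_l1 (p - p') j; rewrite !mxE.
(* [r] lies on the line of [p] at the height of [p']. From [p] to [r] the function [F - G] changes
   by at most [e] per cell. From [r] to [p'] only [F] changes; summing over the levels between [c]
   and [p'], the window bounds this by [2 * e] times the distance. Together they give the factor
   3. *)
pose r := p + (p' ord0 j - p ord0 j) *: evec j.
have rj : r ord0 j = p' ord0 j by rewrite /r !mxE !eqxx mulr1 subrKC.
have FG : `|(F p - G p) - (F p' - G p')| <= 3 * e * dist1 R p p'.
  have h1 : `|(F p - G p) - (F r - G r)| <= e * dist1 R p p'.
    have := @line_lipschitz R d j (fun x => F x - G x) e p (p' ord0 j - p ord0
      j) 0.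
    rewrite scale0r addr0 sub0r normrN -/r => h; apply: le_trans (h _) _.
      move=> x;
        have -> : F x - G x - (F (x - evec j) - G (x - evec j)) = f x - 1.
        by rewrite -Ff -(Gg x); ring.
      exact: fe.
    by rewrite distrC ler_wpM2l.
  have h2 : `|F r - F p'| <= `|p' ord0 j - c|%:~R * (l * (2 * dist1 R p p')).
    have := @line_lipschitz R d j (fun x => F (x + (r - p')) - F x)
      (l * (2 * dist1 R p p')) p' (c - p' ord0 j) 0.
    have Z1 : F (p' + (c - p' ord0 j) *: evec j) = 0.
      by apply: F0; rewrite !mxE !eqxx mulr1 subrKC.
    have Z2 : F (p' + (c - p' ord0 j) *: evec j + (r - p')) = 0.
      apply: F0; rewrite addrAC subrKC mxE rj.
      by rewrite !mxE !eqxx mulr1 subrKC.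
    rewrite scale0r addr0 Z1 Z2 subrr !sub0r subrKC subr0 normrN [ `|c - _|
      ]distrC => h.
    rewrite mulrC; apply: h => x.
    have -> : F (x + (r - p')) - F x - (F (x - evec j + (r - p')) - F (x - evec
      j))
        = f (x + (r - p')) - f x.
      by rewrite -!Ff [x - _ + _]addrAC; ring.
    apply: le_trans (lipschitz_dist1 fl _ _) _; rewrite ler_wpM2l//.
    have -> : dist1 R (x + (r - p')) x = dist1 R r p'.
      by rewrite /dist1 addrAC subrr add0r.
    have := @dist1_shift R d j p p' (p' ord0 j - p ord0 j) 0.
    rewrite scale0r addr0 -/r subr0 distrC; lra.
  have -> : F p - G p - (F p' - G p') = (F p - G p - (F r - G r)) + (F r - F
    p').
    by rewrite /G rj; ring.
  apply: le_trans (ler_normD _ _) _.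
  have : `|p' ord0 j - c|%:~R * (l * (2 * dist1 R p p')) <= 2 * e * dist1 R p
    p'.
    by nra.
  lra.
apply: le_trans (@line_displacement_diff _ _ _ _ _ _ 0 `|(q' - p') ord0 j|%:~R
  _ _ _ _ _ _ _ _ FG pq pq' _) _ => //.
- by move=> x; rewrite Ff; have /andP[] := fb x.
- by move=> x; rewrite Gg; lra.
- by move=> x; rewrite !Gg subrr normr0.
- lra.
Qed.

(** A cell goes to the cube of side [T] that contains it. This turns unit mass per cell into the
    mass of one point of [X] per cube. *)
Lemma block_transport (R : realType) (d T : nat) : (0 < T)%N ->
  exists E : 'rV[int]_d -> 'rV[int]_d -> Prop,
    transport E (fun=> 1 : R) (fun=> T%:R ^+ d) /\
    quasi_isometric (@dist1 R d) (fun z z' => T%:R * dist1 R z z') E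
      1 (d%:R * T%:R).
Proof.
move=> T0; have Tz : 0 < T%:Z by rewrite ltz_nat.
have Tn : T%:Z != 0 by rewrite gt_eqF.
pose b (q : 'rV[int]_d) : 'rV[int]_d :=
  \row_i (q ord0 i %/ T%:Z)%Z.
pose w (q z : 'rV[int]_d) : R := (z == b q)%:R.
have wP q z : 0 < w q z -> z = b q.
  by rewrite /w; case: eqP => // _; rewrite ltxx.
exists (fun q z => 0 < w q z); split.
  apply: coupling_transport; first by move=> q z; rewrite ler0n.
    move=> q; exists [:: b q]; split=> // [z /wP->|]; first exact: mem_head.
    by rewrite big_seq1 /w eqxx.
  move=> z.
  pose q_ (r : 'rV['I_T]_d) : 'rV[int]_d :=
    \row_i (z ord0 i * T%:Z + (r ord0 i : nat)%:Z).
  have bq r : b (q_ r) = z.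
    apply/rowP => i; rewrite !mxE divzMDl//.
    by rewrite divz_small ?addr0// ltz_nat ltn_ord.
  exists [seq q_ r | r <- enum {: 'rV['I_T]_d}]; split.
  - rewrite map_inj_uniq ?enum_uniq// => r r' /rowP h; apply/rowP => i.
    by apply: val_inj; have := h i; rewrite !mxE => /addrI[].
  - move=> q /wP zq; apply/mapP.
    have qT i : (`|(q ord0 i %% T%:Z)%Z|%N < T)%N.
      by rewrite -ltz_nat gez0_abs ?modz_ge0 ?ltz_pmod.
    exists (\row_i Ordinal (qT i)); first by rewrite mem_enum.
    apply/rowP => i; rewrite !mxE /= zq mxE gez0_abs ?modz_ge0//.
    exact: divz_eq.
  - rewrite big_map (eq_bigr (fun=> 1)) => [|r _]; last by rewrite /w bq eqxx.
    rewrite big_enum /= sumr_const card_mx card_ord mul1n.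
    by rewrite natrX.
move=> q z q' z' /wP-> /wP->.
have TE : T%:R * dist1 R (b q) (b q') = (\sum_(i < d) T%:Z * `|(b q - b q')
  ord0 i|)%:~R.
  by rewrite /dist1 /l1 -mulr_sumr intrM.
have dE : d%:R * T%:R = (\sum_(i < d) T%:Z)%:~R :> R.
  by rewrite sumr_const card_ord -[X in X%:~R]mulr_natl intrM natz.
rewrite !mul1r TE dE /dist1 -!intrD !ler_int /l1 -!big_split /=.
have bT (r : 'rV[int]_d) i : 0 <= r ord0 i - T%:Z * b r ord0 i < T%:Z.
  have := divz_eq (r ord0 i) T; have := modz_ge0 (r ord0 i) Tn.
  by have := ltz_pmod (r ord0 i) Tz; rewrite mxE; lia.
have mB (x y : 'rV[int]_d) i : (x - y) ord0 i = x ord0 i - y ord0 i.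
  by rewrite !mxE.
split; apply: ler_sum => i _; have := bT q i; have := bT q' i.
  rewrite !mB.
  move: (b q ord0 i) (b q' ord0 i) (q ord0 i) (q' ord0 i) => x x' y y' h h'.
  have -> : T%:Z * `|x - x'| = `|T%:Z * x - T%:Z * x'|.
    by rewrite -mulrBr normrM.
  lia.
rewrite !mB.
move: (b q ord0 i) (b q' ord0 i) (q ord0 i) (q' ord0 i) => x x' y y' h h'.
have -> : T%:Z * `|x - x'| = `|T%:Z * x - T%:Z * x'|.
  by rewrite -mulrBr normrM.
lia.
Qed.

(** * Multiscale smoothing *)

Definition axis (d' k : nat) : 'I_d'.+1 := inord (k %% d'.+1).

(* Side lengths after [k] doublings done cyclically along the axes. *)
Definition side (d' k : nat) (i : 'I_d'.+1) : nat :=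
  2 ^ (k %/ d'.+1 + (i < k %% d'.+1)).

Lemma side_axis (d' k : nat) : side k (axis d' k) = (2 ^ (k %/ d'.+1))%N.
Proof. by rewrite /side /axis inordK ?ltn_mod// ltnn addn0. Qed.

Lemma side_ge (d' k : nat) (i : 'I_d'.+1) : (2 ^ (k %/ d'.+1) <= side k i)%N.
Proof. by rewrite /side leq_exp2l// leq_addr. Qed.

Lemma side0 (d' : nat) (i : 'I_d'.+1) : side 0 i = 1%N.
Proof. by rewrite /side div0n mod0n. Qed.

Lemma sideS (d' k : nat) (i : 'I_d'.+1) :
  side k.+1 i = if i == axis d' k then (2 * side k i)%N else side k i.
Proof.
rewrite /side -val_eqE /= inordK ?ltn_mod//.
have kE := divn_eq k d'.+1; have rd := ltn_pmod k (ltn0Sn d').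
set a := (k %/ d'.+1)%N in kE *; set r := (k %% d'.+1)%N in kE rd *.
have [rm|rm] := eqVneq r d'.
  have -> : k.+1 = (a.+1 * d'.+1)%N by rewrite kE rm mulSn addnC addSn addnC.
  rewrite mulnK// modnMl ltn0 addn0 rm.
  case: eqP => [->|id]; first by rewrite ltnn addn0 expnS.
  by have -> : (i < d')%N; [have := ltn_ord i; lia|rewrite addn1].
have rs : (r.+1 < d'.+1)%N by lia.
have -> : k.+1 = (a * d'.+1 + r.+1)%N by rewrite kE addnS.
rewrite divnMDl// modnMDl divn_small// modn_small// addn0 ltnS.
case: (ltngtP (val i) r) => /= ir.
- by [].
- by [].
- by rewrite addn0 addn1 expnS.
Qed.

(** [smooth k f p] is the mean of [f] over the box of cells with sides [side k i] whose top corner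
    is [p]. *)
Fixpoint smooth (R : realType) (d' k : nat) (f : 'rV[int]_d'.+1 -> R) :=
  if k is k'.+1 then avg (axis d' k') (2 ^ (k' %/ d'.+1)) (smooth k' f) else f.

Lemma avgC (R : realType) (d : nat) (i j : 'I_d) (s t : nat)
    (f : 'rV[int]_d -> R) : avg i s (avg j t f) = avg j t (avg i s f).
Proof. by apply/funext => p; rewrite /avg [p - _ - _]addrAC; lra. Qed.

Lemma smooth_avg (R : realType) (d' k : nat) (j : 'I_d'.+1) (s : nat)
    (f : 'rV[int]_d'.+1 -> R) : smooth k (avg j s f) = avg j s (smooth k f).
Proof. by elim: k => [//|k IH] /=; rewrite IH avgC. Qed.

Lemma smooth_bounds (R : realType) (d' k : nat) (f : 'rV[int]_d'.+1 -> R)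
    (lo hi : R) :
  (forall p, lo <= f p <= hi) -> forall p, lo <= smooth k f p <= hi.
Proof. by move=> h; elim: k => [//|k IH] /=; apply: avg_bounds. Qed.

(* Telescoping: averaging over the translates by 0, s, 2s, ... is averaging
   over a box, whose increment in a direction only involves opposite faces. *)
Lemma smooth_lipschitz (R : realType) (d' k : nat) (i : 'I_d'.+1)
    (f : 'rV[int]_d'.+1 -> R) (b : R) :
  (forall p, `|f p - f (p - (side k i)%:Z *: evec i)| <= b * (side k i)%:R) ->
  forall p, `|smooth k f p - smooth k f (p - evec i)| <= b.
Proof.
elim: k f => [|k IH] f h p.
  by have := h p; rewrite side0 scale1r mulr1.
rewrite /= -smooth_avg; apply: IH => {}p; move: h; rewrite sideS.
case: eqVneq => [->|_] h.
  set t := side k _; rewrite /avg -side_axis -/t.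
  have -> : p - t%:Z *: evec (axis d' k) - t%:Z *: evec (axis d' k)
      = p - (2 * t)%N%:Z *: evec (axis d' k).
    by rewrite -addrA -opprD -scalerDl mul2n -addnn.
  have := h p; rewrite -/t natrM !ler_norml.
  by move=> /andP[? ?]; apply/andP; split; lra.
have := h p; have := h (p - (2 ^ (k %/ d'.+1))%N%:Z *: evec (axis d' k)).
rewrite /avg addrAC.
by rewrite !ler_norml => /andP[? ?] /andP[? ?]; apply/andP; split; lra.
Qed.

Lemma id_transport (R : realType) (S : eqType) (f : S -> R) :
  (forall p, 0 <= f p) ->
  exists E, transport E f f /\ (forall p q, E p q -> q = p).
Proof.
move=> f0; pose w (p q : S) := f p * (q == p)%:R.
have wP p q : 0 < w p q -> q = p.
  by rewrite /w; case: eqP => // _; rewrite mulr0 ltxx.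
exists (fun p q => 0 < w p q); split=> //.
apply: coupling_transport; first by move=> p q; rewrite mulr_ge0.
  move=> p; exists [:: p]; split=> // [q /wP->|]; first exact: mem_head.
  by rewrite big_seq1 /w eqxx mulr1.
move=> q; exists [:: q]; split=> // [p /wP->|]; first exact: mem_head.
by rewrite big_seq1 /w eqxx mulr1.
Qed.

Lemma smooth2_close (R : realType) (d' k : nat) (f : 'rV[int]_d'.+1 -> R) (e :
  R) :
  (forall p, `|smooth k f p - 1| <= e) ->
  forall p, `|smooth k (smooth k f) p - 1| <= e.
Proof.
move=> he p.
have h q : 1 - e <= smooth k f q <= 1 + e.
  by have := he q; rewrite ler_norml => /andP[? ?]; apply/andP; split; lra.
have := smooth_bounds k h p; rewrite ler_norml => /andP[? ?].
by apply/andP; split; lra.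
Qed.

(** The inner smoothing has oscillation at most [2 * e], and averaging it over a box of side s
    leaves increments of at most [2 * e / s]. *)
Lemma smooth2_lipschitz (R : realType) (d' k : nat) (f : 'rV[int]_d'.+1 -> R)
    (e : R) :
  (forall p, `|smooth k f p - 1| <= e) ->
  forall i p, `|smooth k (smooth k f) p - smooth k (smooth k f) (p - evec i)|
    <= 2 * e / (2 ^ (k %/ d'.+1))%N%:R.
Proof.
move=> he i; apply: smooth_lipschitz => p.
have e0 : 0 <= e by apply: le_trans (he p).
apply: (@le_trans _ _ (2 * e)).
  have := he p; have := he (p - (side k i)%:Z *: evec i).
  by rewrite !ler_norml => /andP[? ?] /andP[? ?]; apply/andP; split; lra.
rewrite -mulrA ler_peMr ?mulr_ge0//.
rewrite mulrC ler_pdivlMr ?ltr0n ?expn_gt0// mul1r ler_nat.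
exact: side_ge.
Qed.

Section Chain.
Context {R : realType} {d' : nat} (f0 : 'rV[int]_d'.+1 -> R).
Let d := d'.+1.
Let dist := @dist1 R d.
Let f k := smooth k (smooth k f0).

Let fS k : f k.+1 = avg (axis d' k) (2 ^ (k %/ d)) (avg (axis d' k) (2 ^ (k %/
  d)) (f k)).
Proof. by rewrite /f /= smooth_avg. Qed.

Let smooth2_ge0 : (forall p, 0 <= f0 p) -> forall k p, 0 <= f k p.
Proof.
move=> f00 k p.
have sm0 g : (forall p, 0 <= g p) -> forall p, 0 <= smooth k g p.
  by move=> h; elim: (k) => [//|m IH] q /=; rewrite divr_ge0// addr_ge0.
exact/sm0/sm0.
Qed.

(** Doubling a side s takes two averagings, each with error [2 * s], while the sum of the sides
    grows by s; hence the factor 4. The total error is proportional to the final scale alone. *)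
Lemma chain_coarse (k : nat) : (forall p, 0 <= f0 p) ->
  exists E, transport E f0 (smooth k (smooth k f0)) /\
    quasi_isometric dist dist E 1 (4 * \sum_(i < d'.+1) (side k i)%:R).
Proof.
move=> f00; rewrite -/(f k).
have fk0 := smooth2_ge0 f00.
elim: k => [|k [E [Et Eq]]].
  have [E [Et Eeq]] := id_transport f00; exists E; split=> //.
  move=> p q p' q' /Eeq-> /Eeq->; rewrite !mul1r.
  by split; rewrite lerDl mulr_ge0// sumr_ge0.
have s0 : (0 < 2 ^ (k %/ d))%N by rewrite expn_gt0.
have [E1 [t1 q1]] := @avg_transport_coarse R d (axis d' k) _ (f k) s0 (fk0 k).
have fk0' p : 0 <= avg (axis d' k) (2 ^ (k %/ d)) (f k) p.
  by rewrite divr_ge0// addr_ge0.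
have [E2 [t2 q2]] := @avg_transport_coarse R d (axis d' k) _ _ s0 fk0'.
exists (rcomp (rcomp E E1) E2); split.
  rewrite -/(f k.+1) fS; apply: transport_comp t2; exact: transport_comp t1.
have C0 : 0 <= 4 * \sum_(i < d'.+1) (side k i)%:R :> R by rewrite mulr_ge0//
  sumr_ge0.
have C1 : 0 <= 2 * (2 ^ (k %/ d))%N%:R :> R by rewrite mulr_ge0.
have := quasi_isometric_comp _ _ _ _ (quasi_isometric_comp _ _ _ _ Eq q1) q2.
rewrite !mulr1 => /(_ _ _ _ _ _ _ _ _)H.
have -> : 4 * \sum_(i < d'.+1) (side k.+1 i)%:R = 4 * \sum_(i < d'.+1) (side k
  i)%:R +
    2 * (2 ^ (k %/ d))%N%:R + 2 * (2 ^ (k %/ d))%N%:R :> R.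
  rewrite (bigD1 (axis d' k)) //= [in RHS](bigD1 (axis d' k)) //=.
  rewrite sideS eqxx side_axis natrM.
  rewrite (eq_bigr (fun i => (side k i)%:R)); first by ring.
  by move=> i /negPf ik; rewrite sideS ik.
by apply: H => //; rewrite addr_ge0.
Qed.

(** Each scale has two averagings with [s * l = 2 * e k], each costing a factor [1 + 44 * e k] and
    12 cells. The two factors together are at most [1 + 96 * e k]; the product so far is at most 2,
    so it grows by at most [192 * e k], which [264 * e k] covers. *)
Lemma chain_fine (k0 n : nat) (e : nat -> R) :
  (forall p, 0 <= f0 p) ->
  (forall k p, (k0 <= k)%N -> `|smooth k f0 p - 1| <= e k) ->
  264 * \sum_(k0 <= k < k0 + n) e k <= 1 ->
  exists E, transport E (smooth k0 (smooth k0 f0))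
      (smooth (k0 + n) (smooth (k0 + n) f0)) /\
    quasi_isometric dist dist E (1 + 264 * \sum_(k0 <= k < k0 + n) e k)
      (24 * n%:R).
Proof.
move=> f00 he; rewrite -/(f k0) -/(f (k0 + n)).
have e0 k : (k0 <= k)%N -> 0 <= e k by move=> hk; apply: le_trans (he k 0 hk).
have f1 k p : (k0 <= k)%N -> `|f k p - 1| <= e k.
  by move=> hk; apply: smooth2_close => q; exact: he.
have fl k i p : (k0 <= k)%N ->
    `|f k p - f k (p - evec i)| <= 2 * e k / (2 ^ (k %/ d))%N%:R.
  by move=> hk; apply: smooth2_lipschitz => q; exact: he.
have fb k p : (k0 <= k)%N -> 264 * e k <= 1 -> 1 / 2 <= f k p <= 3 / 2.
  move=> hk ek; have := f1 k p hk.
  by rewrite ler_norml => /andP[? ?]; apply/andP; split; lra.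
have sum0 n' : 0 <= \sum_(k0 <= k < k0 + n') e k.
  by rewrite big_nat_cond sumr_ge0// => k /andP[/andP[/e0]].
elim: n => [|n IH].
  rewrite addn0 big_geq// mulr0 addr0 mulr0 => _.
  have [E [Et Eeq]] := id_transport (smooth2_ge0 f00 k0); exists E; split=> //.
  by move=> p q p' q' /Eeq-> /Eeq->; rewrite !mul1r addr0.
have hk : (k0 <= k0 + n)%N by rewrite leq_addr.
rewrite addnS big_nat_recr//= mulrDr => eS.
have eS' : 264 * \sum_(k0 <= k < k0 + n) e k <= 1 by have := e0 _ hk; lra.
have [E [Et Eq]] := IH eS'.
set k := (k0 + n)%N in hk eS Et Eq *.
have ek0 := e0 k hk; have s0 := sum0 n; rewrite -/k in s0.
have ek1 : 264 * e k <= 1 by lra.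
have sg0 : (0 < 2 ^ (k %/ d))%N by rewrite expn_gt0.
have sl : (2 ^ (k %/ d))%N%:R * (2 * e k / (2 ^ (k %/ d))%N%:R) = 2 * e k.
  by rewrite mulrC divfK// pnatr_eq0 -lt0n.
have l0 : 0 <= 2 * e k / (2 ^ (k %/ d))%N%:R by rewrite divr_ge0 ?mulr_ge0.
have fbk p := fb k p hk ek1.
have flk i p := fl k i p hk.
have sm : 11 * ((2 ^ (k %/ d))%N%:R * (2 * e k / (2 ^ (k %/ d))%N%:R)) <= 1 / 2.
  by rewrite sl; lra.
have [E1 [t1 q1]] := avg_transport (axis d' k) sg0 l0 fbk flk sm.
have fbk' := avg_bounds (axis d' k) (2 ^ (k %/ d)) fbk.
have flk' i := avg_lipschitz (axis d' k) (2 ^ (k %/ d)) (flk i).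
have [E2 [t2 q2]] := avg_transport (axis d' k) sg0 l0 fbk' flk' sm.
rewrite sl in q1 q2.
exists (rcomp (rcomp E E1) E2); split.
  rewrite fS; apply: transport_comp t2; exact: transport_comp t1.
have K1 : 1 <= 1 + 264 * \sum_(k0 <= i < k) e i by lra.
have K2 : 1 <= 1 + 22 * (2 * e k) by lra.
have C0 : 0 <= 24 * n%:R :> R by rewrite mulr_ge0.
have C12 : 0 <= 12 :> R by lra.
have qq := quasi_isometric_comp K1 K2 C0 C12 Eq q1.
have K3 : 1 <= (1 + 264 * \sum_(k0 <= i < k) e i) * (1 + 22 * (2 * e k)) by nra.
have C24 : 0 <= 24 * n%:R + 12 :> R by lra.
have {qq} := quasi_isometric_comp K3 K2 C24 C12 qq q2.
have -> : 24 * n%:R + 12 + 12 = 24 * n.+1%:R :> R by rewrite -[n.+1]addn1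
  natrD; ring.
move=> qq p q p' q' pq pq'; have [h1 h2] := qq _ _ _ _ pq pq'.
have KK : (1 + 264 * \sum_(k0 <= i < k) e i) * (1 + 22 * (2 * e k)) *
    (1 + 22 * (2 * e k)) <= 1 + (264 * \sum_(k0 <= i < k) e i + 264 * e k).
  have : (1 + 22 * (2 * e k)) * (1 + 22 * (2 * e k)) <= 1 + 96 * e k by nra.
  by move: (\sum_(k0 <= i < k) e i) s0 eS => S S0 eS; nra.
have n0 : 0 <= 24 * n.+1%:R :> R by rewrite mulr_ge0.
split; [apply: (le_trans h1)|apply: (le_trans h2)];
  apply: ler_wpM2r => //; rewrite addr_ge0 ?dist1_ge0//.
Qed.

Lemma chain_fine_le2 (k0 n : nat) (e : nat -> R) :
  (forall p, 0 <= f0 p) ->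
  (forall k p, (k0 <= k)%N -> `|smooth k f0 p - 1| <= e k) ->
  264 * \sum_(k0 <= k < k0 + n) e k <= 1 ->
  exists E, transport E (smooth k0 (smooth k0 f0))
      (smooth (k0 + n) (smooth (k0 + n) f0)) /\
    quasi_isometric dist dist E 2 (24 * n%:R).
Proof.
move=> f00 he he1; have [E [Et Eq]] := chain_fine f00 he he1; exists E;
  split=> //.
have n0 : 0 <= 24 * n%:R :> R by apply: mulr_ge0.
have K2 : 1 + 264 * \sum_(k0 <= k < k0 + n) e k <= 2 by lra.
move=> p q p' q' pq pq'; have [h1 h2] := Eq _ _ _ _ pq pq'.
split; [apply: le_trans h1 _|apply: le_trans h2 _];
  by apply: ler_wpM2r => //; apply: addr_ge0 => //; exact: dist1_ge0.
Qed.
End Chain.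

(** * Marriage, ultrafilter limits and Cantor-Bernstein *)

Section FiniteHall.
Context (I J : finType).
Implicit Types (r : {set I * J}) (A : {set I}).

Definition nbrs r A : {set J} := [set y | [exists x in A, (x, y) \in r]].

Definition hall r := [forall A : {set I}, #|A| <= #|nbrs r A|]%N.

Lemma nbrsP r A y : reflect (exists2 x, x \in A & (x, y) \in r) (y \in nbrs r
  A).
Proof. by rewrite inE; apply: exists_inP. Qed.

(* Rado: by submodularity of the number of neighbours, a minimal relation with
   Hall's property is the graph of a function. *)
Lemma hall_minimal r x y1 y2 : minset hall r ->
  (x, y1) \in r -> (x, y2) \in r -> y1 = y2.
Proof.
move=> /minsetP[rH rmin] r1 r2; apply/eqP/negPn/negP => y12.
(* Dropping the edge from [x] to [y] violates Hall's condition at some [B]. This [B] contains [x],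
   since otherwise its neighbours would be unchanged. *)
have key y : (x, y) \in r -> exists B : {set I},
    [/\ x \in B & #|nbrs (r :\ (x, y)) B| <= #|B :\ x|]%N.
  move=> ry; have : ~~ hall (r :\ (x, y)).
    apply/negP => h; have := rmin _ h (subsetDl _ _).
    by move=> /setP /(_ (x, y)); rewrite !inE eqxx ry.
  rewrite negb_forall => /existsP[B]; rewrite -ltnNge => hB; exists B.
  have xB : x \in B.
    apply/negPn/negP => xB; move/forallP: rH => /(_ B);
      rewrite leqNgt => /negP; apply.
    apply: leq_trans _ hB; rewrite ltnS;
      apply/subset_leq_card/fintype.subsetP => z.
    move=> /nbrsP[u uB uz]; apply/nbrsP; exists u => //; rewrite !inE uz andbT.
    by apply: contra xB => /eqP[<-].
  by split=> //; rewrite (cardsD1 x B) xB in hB.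
have [B1 [x1 c1]] := key _ r1; have [B2 [x2 c2]] := key _ r2.
set V1 := nbrs _ B1 in c1; set V2 := nbrs _ B2 in c2.
set A1 := B1 :\ x in c1; set A2 := B2 :\ x in c2.
(* No neighbour of [x] is lost in the union: the edge to [y1] survives in the second relation, and
   all other edges survive in the first. *)
have hU : (#|x |: (A1 :|: A2)| <= #|V1 :|: V2|)%N.
  move/forallP: rH => /(_ (x |: (A1 :|: A2))) h; apply: (leq_trans h).
  apply/subset_leq_card/fintype.subsetP => y /nbrsP[u]; rewrite in_setU1.
  have [-> _ ry|ux /=] := eqVneq u x.
    rewrite inE; have [yy1|yy1] := eqVneq y y1.
      apply/orP; right; apply/nbrsP; exists x => //.
      by rewrite !inE ry andbT xpair_eqE eqxx /= yy1.
    apply/orP; left; apply/nbrsP; exists x => //.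
    by rewrite !inE ry andbT xpair_eqE eqxx.
  rewrite !inE ux /= => /orP[uB|uB] uy; apply/orP; [left|right];
    by apply/existsP; exists u; rewrite uB !inE uy xpair_eqE (negPf ux).
have hI : (#|A1 :&: A2| <= #|V1 :&: V2|)%N.
  move/forallP: rH => /(_ (A1 :&: A2)) h; apply: (leq_trans h).
  apply/subset_leq_card/fintype.subsetP => y /nbrsP[u]; rewrite !inE.
  move=> /andP[/andP[ux u1] /andP[_ u2]] uy.
  by apply/andP; split; apply/existsP; exists u;
    rewrite ?u1 ?u2 !inE uy xpair_eqE (negPf ux).
have cU : (#|x |: (A1 :|: A2)| = #|A1 :|: A2|.+1)%N.
  by rewrite cardsU1 !inE eqxx.
have := cardsUI A1 A2; have := cardsUI V1 V2.
by move: hU; rewrite cU; lia.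
Qed.

Lemma hall_marriage r : hall r ->
  exists f : I -> J, injective f /\ forall x, (x, f x) \in r.
Proof.
move=> rH; have [r' rmin r'r] := minset_exists rH.
have r'H : hall r' by have /minsetP[] := rmin.
have ex x : exists y, (x, y) \in r'.
  move/forallP: r'H => /(_ [set x]); rewrite cards1 => /card_gt0P[y /nbrsP[u]].
  by rewrite inE => /eqP-> uy; exists y.
exists (fun x => xchoose (ex x)); split; last first.
  by move=> x; apply: (fintype.subsetP r'r); exact: (xchooseP (ex x)).
move=> x x' xx'; apply/eqP/negPn/negP => nxx'.
move/forallP: r'H => /(_ [set x; x']); rewrite cards2 nxx' leqNgt => /negP;
  apply.
rewrite ltnS -[nat_of_bool true]/1%N -(cards1 (xchoose (ex x)));
  apply/subset_leq_card/fintype.subsetP => y.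
move=> /nbrsP[u]; rewrite !inE => /orP[]/eqP-> uy; apply/eqP.
  exact: (hall_minimal rmin uy (xchooseP (ex x))).
by rewrite xx'; exact: (hall_minimal rmin uy (xchooseP (ex x'))).
Qed.

End FiniteHall.

Lemma hall_seq (T U : eqType) (u0 : U) (E : T -> U -> Prop) (A : seq T) :
  uniq A -> image_finite E ->
  (forall (A' : seq T) (B : seq U), uniq A' -> uniq B -> {subset A' <= A} ->
     (forall x y, x \in A' -> E x y -> y \in B) -> (size A' <= size B)%N) ->
  exists f : T -> U, {in A &, injective f} /\ {in A, forall x, E x (f x)}.
Proof.
case: A => [|x0 A']; first by exists (fun=> u0); split=> x.
set A := x0 :: A' => uA Efin Ehall.
have [Z uZ hZ] := image_finite_seq A Efin.
pose r := [set ij : 'I_(size A) * 'I_(size Z) |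
  `[< E (nth x0 A ij.1) (nth u0 Z ij.2) >]]%SET.
have rH : hall r.
  apply/forallP => B; rewrite !cardE.
  rewrite -(size_map (fun i : 'I_(size A) => nth x0 A i)).
  rewrite -[leqRHS](size_map (fun j : 'I_(size Z) => nth u0 Z j)).
  apply: Ehall.
  - rewrite map_inj_uniq ?enum_uniq// => i i' /eqP.
    by rewrite nth_uniq// => /eqP/val_inj.
  - rewrite map_inj_uniq ?enum_uniq// => i i' /eqP.
    by rewrite nth_uniq// => /eqP/val_inj.
  - by move=> x /mapP[i _ ->]; exact: mem_nth.
  - move=> x y /mapP[i]; rewrite mem_enum => iB -> Ey.
    have yZ : y \in Z by apply/hZ; exists (nth x0 A i) => //; exact: mem_nth.
    have yi : (index y Z < size Z)%N by rewrite index_mem.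
    apply/mapP; exists (Ordinal yi); last by rewrite /= nth_index.
    rewrite mem_enum; apply/nbrsP; exists i => //.
    by rewrite inE; apply/asboolP; rewrite /= nth_index.
have [f [finj fr]] := hall_marriage rH.
have iA x (xA : x \in A) : (index x A < size A)%N by rewrite index_mem.
pose g x := if insub (index x A) is Some i then nth u0 Z (f i) else u0.
have gE x (xA : x \in A) : g x = nth u0 Z (f (Ordinal (iA x xA))).
  by rewrite /g; case: insubP => [i _ iE|]; [congr (nth _ _ (f _));
    exact: val_inj|rewrite iA].
exists g; split=> [x y xA yA|x xA].
  rewrite (gE x xA) (gE y yA) => /eqP; rewrite nth_uniq// => /eqP/val_inj/finj.
  move=> /(congr1 val) e; have {}e : index x A = index y A by exact: e.
  by rewrite -(nth_index x0 xA) e nth_index.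
by have := fr (Ordinal (iA x xA)); rewrite inE => /asboolP;
  rewrite /= nth_index// (gE x xA).
Qed.

Local Open Scope classical_set_scope.

(** Pigeonhole principle along an ultrafilter. *)
Lemma ultra_finite_const (T : eqType) (F : set_system nat) (s : seq T)
    (u : nat -> T) : UltraFilter F -> F [set n | u n \in s] ->
  exists x, x \in s /\ F [set n | u n = x].
Proof.
move=> FU; elim: s => [|x s IH] h.
  by have /filter_ex[n] : F [set n | u n \in [::]] by [].
have [hx|hx] := in_ultra_setVsetC [set n | u n = x] FU.
  by exists x; rewrite mem_head.
have [|y [ys hy]] := IH; last by exists y; rewrite inE ys orbT.
apply: filterS (filterI h hx) => n /= [].
by rewrite inE => /orP[/eqP|].
Qed.

(** At every point the bijection is [f] or an inverse of [g], so it stays inside a relation [S] that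
    contains both. Estimates attached to the relation are thereby inherited. *)
Lemma schroeder_bernstein_rel (T U : Type) (S : T -> U -> Prop) (A : set T)
    (B : set U) (f : T -> U) (g : U -> T) :
  (forall x, A x -> B (f x) /\ S x (f x)) ->
  (forall x y, A x -> A y -> f x = f y -> x = y) ->
  (forall y, B y -> A (g y) /\ S (g y) y) ->
  (forall x y, B x -> B y -> g x = g y -> x = y) ->
  exists (h : T -> U) (k : U -> T),
    [/\ forall x, A x -> [/\ B (h x), S x (h x) & k (h x) = x]
      & forall y, B y -> A (k y) /\ h (k y) = y].
Proof.
move=> hf finj hg ginj.
(* Points obtained by [n] round trips from points of [A] outside the image of [g]; on these the
   bijection is [f]. *)
pose Cn := fix Cn n : set T := if n is n'.+1 then [set g (f x) | x in Cn n']
  else [set x | A x /\ ~ exists2 y, B y & g y = x].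
have CnA n x : Cn n x -> A x.
  elim: n x => [|n IH] x /=; first by case.
  by move=> [z /IH Az <-]; have [Bz _] := hf z Az; have [] := hg _ Bz.
pose C x := exists n, Cn n x.
have ginvP x : exists y, (A x -> ~ C x -> B y /\ g y = x).
  have [[y By gy]|nex] := pselect (exists2 y, B y & g y = x); first by exists y.
  by exists (f x) => Ax nC; exfalso; apply: nC; exists 0%N.
pose ginv x := projT1 (cid (ginvP x)).
have ginvE x : A x -> ~ C x -> B (ginv x) /\ g (ginv x) = x.
  exact: projT2 (cid (ginvP x)).
pose h x := if pselect (C x) then f x else ginv x.
have hC x : C x -> h x = f x by rewrite /h; case: pselect.
have hN x : ~ C x -> h x = ginv x by rewrite /h; case: pselect.
have hB x : A x -> B (h x) /\ S x (h x).
  move=> Ax; have [Cx|nCx] := pselect (C x); first by rewrite hC//; exact: hf.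
  have [By gy] := ginvE x Ax nCx; rewrite hN//; split=> //.
  by have [_] := hg _ By; rewrite gy.
have hinj x y : A x -> A y -> h x = h y -> x = y.
  have aux u v : A u -> A v -> C u -> ~ C v -> h u = h v -> u = v.
    move=> Au Av [n Cu] nCv; rewrite hC; last by exists n.
    rewrite hN// => e; exfalso; have [_ gv] := ginvE v Av nCv.
    by apply: nCv; exists n.+1; exists u => //; rewrite e.
  move=> Ax Ay; have [Cx|nCx] := pselect (C x); have [Cy|nCy] := pselect (C y).
  - by rewrite !hC//; exact: finj.
  - exact: aux.
  - by move=> e; symmetry; apply: aux.
  - rewrite !hN// => e; have [_ <-] := ginvE x Ax nCx.
    by have [_ <-] := ginvE y Ay nCy; rewrite e.
have hsurj y : exists x, B y -> A x /\ h x = y.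
  have [By|nBy] := pselect (B y); last by exists (g y).
  have [Agy _] := hg y By.
  have [[n Cgy]|nC] := pselect (C (g y)); last first.
    exists (g y) => _; split=> //; have [Bi gi] := ginvE _ Agy nC.
    by rewrite (hN _ nC); exact: (ginj _ _ Bi By gi).
  case: n Cgy => [[_ []]|n /= [c Cc gfc]]; first by exists y.
  exists c => _; have Ac := CnA _ _ Cc; split=> //.
  rewrite hC; last by exists n.
  by apply: ginj => //; have [] := hf c Ac.
exists h, (fun y => projT1 (cid (hsurj y))); split=> [x Ax|y By].
  have [Bh Sh] := hB x Ax; split=> //.
  by have [Ak hk] := projT2 (cid (hsurj (h x))) Bh; apply: hinj.
exact: projT2 (cid (hsurj y)) By.
Qed.

(** * Counting points in boxes *)

Definition setc (R : Type) (d : nat) (a : 'rV[R]_d) (i : 'I_d) (t : R) :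
  'rV[R]_d :=
  \row_j if j == i then t else a ord0 j.

Lemma setc_eq (R : Type) (d : nat) (a : 'rV[R]_d) (i : 'I_d) (t : R) :
  setc a i t ord0 i = t.
Proof. by rewrite mxE eqxx. Qed.

Lemma setc_neq (R : Type) (d : nat) (a : 'rV[R]_d) (i j : 'I_d) (t : R) :
  j != i -> setc a i t ord0 j = a ord0 j.
Proof. by rewrite mxE => /negPf->. Qed.

(** Half-open, so that a cut produces disjoint boxes and counts are additive. *)
Definition box (R : realType) (d : nat) (a b : 'rV[R]_d) : set 'rV[R]_d :=
  [set x | forall i, a ord0 i <= x ord0 i < b ord0 i].

Definition vol (R : realType) (d : nat) (a b : 'rV[R]_d) : R :=
  \prod_(i < d) (b ord0 i - a ord0 i).

(** [fset_set] is empty on infinite sets; for a Delone set [finite_box] excludes this case on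
    boxes. *)
Definition npts (R : realType) (d : nat) (X : set 'rV[R]_d)
    (A : set 'rV[R]_d) : R := (#|` fset_set (X `&` A)|)%:R.

(** A side longer than [2 * s] is cut at distance [s] from its lower end. Both pieces keep sides at
    least [s], and in each the sum of the sides drops by at least [s], which bounds the depth of the
    induction. *)
Lemma box_induction (R : realType) (d : nat) (s : R)
    (P : 'rV[R]_d -> 'rV[R]_d -> Prop) : 0 < s ->
  (forall a b : 'rV[R]_d, (forall i, s <= b ord0 i - a ord0 i <= 2 * s) -> P a
    b) ->
  (forall (a b : 'rV[R]_d) i t, a ord0 i <= t <= b ord0 i ->
    P a (setc b i t) -> P (setc a i t) b -> P a b) ->
  forall a b : 'rV[R]_d, (forall i, s <= b ord0 i - a ord0 i) -> P a b.
Proof.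
move=> s0 Psmall Pcut.
pose S (a b : 'rV[R]_d) := \sum_i (b ord0 i - a ord0 i).
suff H (n : nat) (a b : 'rV[R]_d) : (forall i, s <= b ord0 i - a ord0 i) ->
    S a b <= n%:R * s -> P a b.
  move=> a b hab; apply: (H (Num.bound (S a b / s))) => //.
  rewrite -ler_pdivrMr// ltW// archi_boundP// divr_ge0 ?(ltW s0)//.
  by apply: sumr_ge0 => i _; apply: le_trans (hab i); apply: ltW.
elim: n a b => [|n IH] a b hab Sab.
  apply: Psmall => i; rewrite hab /=.
  have : b ord0 i - a ord0 i <= S a b.
    rewrite /S (bigD1 i)//= lerDl sumr_ge0// => j _.
    by apply: le_trans (hab j); apply: ltW.
  by move: Sab; rewrite mul0r; lra.
have [small|] := pselect (forall i, b ord0 i - a ord0 i <= 2 * s).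
  by apply: Psmall => i; rewrite hab small.
move=> /existsNP[i /negP]; rewrite -ltNge => big.
pose t := a ord0 i + s.
have SE1 : S a (setc b i t) = S a b - (b ord0 i - t).
  rewrite /S (bigD1 i)//= [in RHS](bigD1 i)//= setc_eq.
  rewrite (eq_bigr (fun j => b ord0 j - a ord0 j)); first by ring.
  by move=> j ji; rewrite setc_neq.
have SE2 : S (setc a i t) b = S a b - (t - a ord0 i).
  rewrite /S (bigD1 i)//= [in RHS](bigD1 i)//= setc_eq.
  rewrite (eq_bigr (fun j => b ord0 j - a ord0 j)); first by ring.
  by move=> j ji; rewrite setc_neq.
apply: (Pcut a b i t).
- by rewrite /t; apply/andP; split; lra.
- apply: IH => [j|].
    have [->|ji] := eqVneq j i; last by rewrite setc_neq.
    by rewrite setc_eq /t; lra.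
  by rewrite SE1 /t; move: Sab; rewrite -[n.+1]addn1 natrD; lra.
apply: IH => [j|].
  have [->|ji] := eqVneq j i; last by rewrite setc_neq.
  by rewrite setc_eq /t; lra.
by rewrite SE2 /t; move: Sab; rewrite -[n.+1]addn1 natrD; lra.
Qed.

Lemma vol_cut (R : realType) (d : nat) (a b : 'rV[R]_d) i t :
  vol a b = vol a (setc b i t) + vol (setc a i t) b.
Proof.
rewrite /vol (bigD1 i)//= [in X in _ = X + _](bigD1 i)//=.
rewrite [in X in _ = _ + X](bigD1 i)//= !setc_eq.
rewrite [in X in _ = X + _](eq_bigr (fun j => b ord0 j - a ord0 j)) => [|j ji].
  rewrite [in X in _ = _ + X](eq_bigr (fun j => b ord0 j - a ord0 j)) => [|j
    ji].
    by ring.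
  by rewrite setc_neq.
by rewrite setc_neq.
Qed.

Lemma box_cut (R : realType) (d : nat) (a b : 'rV[R]_d) i t :
  a ord0 i <= t <= b ord0 i ->
  box a b = box a (setc b i t) `|` box (setc a i t) b.
Proof.
move=> /andP[h1 h2]; apply/seteqP; split=> [x xab|x []xab j].
- have [xt|xt] := ltP (x ord0 i) t; [left|right] => j;
    have := xab j; have [->|ji] := eqVneq j i; rewrite ?setc_eq ?setc_neq//;
    by move=> /andP[? ?]; apply/andP; split; lra.
- have := xab j; have [->|ji] := eqVneq j i; rewrite ?setc_eq ?setc_neq//.
  by move=> /andP[? ?]; apply/andP; split; lra.
- have := xab j; have [->|ji] := eqVneq j i; rewrite ?setc_eq ?setc_neq//.
  by move=> /andP[? ?]; apply/andP; split; lra.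
Qed.

Lemma nptsU (R : realType) (d : nat) (X A B : set 'rV[R]_d) :
  finite_set (X `&` A) -> finite_set (X `&` B) -> A `&` B = set0 ->
  npts X (A `|` B) = npts X A + npts X B.
Proof.
move=> fA fB AB; rewrite /npts setIUr fset_setU// -natrD; congr (_%:R).
rewrite cardfsU -fset_setI//.
have -> : X `&` A `&` (X `&` B) = set0 by rewrite setIACA AB setI0.
by rewrite fset_set0 cardfs0 subn0.
Qed.

Lemma npts_box_cut (R : realType) (d : nat) (X : set 'rV[R]_d)
    (a b : 'rV[R]_d) i t :
  (forall a b, finite_set (X `&` box a b)) ->
  a ord0 i <= t <= b ord0 i ->
  npts X (box a b) = npts X (box a (setc b i t)) + npts X (box (setc a i t) b).
Proof.
move=> fX ht; rewrite (box_cut ht) nptsU//.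
apply/seteqP; split=> // x [/(_ i) + /(_ i)]; rewrite !setc_eq.
by move=> /andP[_ ?] /andP[? _]; lra.
Qed.

Definition additive_on_boxes (R : realType) (d : nat)
    (D : 'rV[R]_d -> 'rV[R]_d -> R) :=
  forall (a b : 'rV[R]_d) i t, a ord0 i <= t <= b ord0 i ->
    D a b = D a (setc b i t) + D (setc a i t) b.

(** The inner box is reached by trimming one coordinate after another. Nonnegativity is known only
    for boxes with sides at least [s], so the slabs cut off must be that thick; hence the margin
    [s]. *)
Lemma box_sub_le (R : realType) (d : nat) (D : 'rV[R]_d -> 'rV[R]_d -> R) (s :
  R)
    (a b a' b' : 'rV[R]_d) : 0 <= s ->
  additive_on_boxes D ->
  (forall a b : 'rV[R]_d, (forall i, s <= b ord0 i - a ord0 i) -> 0 <= D a b) ->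
  (forall i, [/\ a ord0 i + s <= a' ord0 i, s <= b' ord0 i - a' ord0 i
     & b' ord0 i + s <= b ord0 i]) ->
  D a' b' <= D a b.
Proof.
move=> s0 Dadd D0 hab.
pose m (l : seq 'I_d) (x x' : 'rV[R]_d) : 'rV[R]_d :=
  \row_j if j \in l then x' ord0 j else x ord0 j.
have mE l (x x' : 'rV[R]_d) j : m l x x' ord0 j = if j \in l then x' ord0 j
  else x ord0 j.
  by rewrite mxE.
suff H l : D (m l a a') (m l b b') <= D a b.
  have := H (enum 'I_d).
  have mm x x' : m (enum 'I_d) x x' = x'.
    by apply/rowP => j; rewrite mE mem_enum.
  by rewrite !mm.
elim: l => [|i l IH].
  have mm x x' : m [::] x x' = x by apply/rowP => j; rewrite mE.
  by rewrite !mm.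
have [il|il] := boolP (i \in l).
  have mm x x' : m (i :: l) x x' = m l x x'.
    by apply/rowP => j; rewrite !mE inE; case: eqP => // ->; rewrite il.
  by rewrite !mm.
apply: le_trans IH.
have mm x x' : m (i :: l) x x' = setc (m l x x') i (x' ord0 i).
  apply/rowP => j; rewrite mE inE; have [->|ji] := eqVneq j i.
    by rewrite setc_eq.
  by rewrite setc_neq// mE.
have [h1 h2 h3] := hab i.
have sides (x y : 'rV[R]_d) : (forall j, j != i -> x ord0 j = m l a a' ord0 j)
  ->
   (forall j, j != i -> y ord0 j = m l b b' ord0 j) ->
   s <= y ord0 i - x ord0 i -> forall j, s <= y ord0 j - x ord0 j.
  move=> hx hy hi j; have [->//|ji] := eqVneq j i.
  rewrite hx// hy// !mE; have [g1 g2 g3] := hab j.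
  by case: ifP => _ //; lra.
rewrite (Dadd (m l a a') _ i (a' ord0 i)); last first.
  by rewrite !mE (negPf il); apply/andP; split; lra.
rewrite -mm (Dadd (m (i :: l) a a') (m l b b') i (b' ord0 i)); last first.
  by rewrite !mE mem_head (negPf il); apply/andP; split; lra.
rewrite -mm.
have p1 : 0 <= D (m l a a') (setc (m l b b') i (a' ord0 i)).
  apply: D0; apply: sides => // [j ji|]; first by rewrite setc_neq.
  by rewrite setc_eq mE (negPf il); lra.
have p2 : 0 <= D (setc (m (i :: l) a a') i (b' ord0 i)) (m l b b').
  apply: D0; apply: sides => // [j ji|].
    by rewrite setc_neq// !mE inE (negPf ji).
  by rewrite setc_eq mE (negPf il); lra.
lra.
Qed.

Lemma coord_le_enorm (R : realType) (d : nat) (x : 'rV[R]_d) i :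
  `|x ord0 i| <= enorm x.
Proof.
rewrite -sqrtr_sqr /enorm ler_sqrt ?sumr_ge0//; last by move=> j _;
  rewrite sqr_ge0.
by rewrite (bigD1 i)//= lerDl sumr_ge0// => j _; rewrite sqr_ge0.
Qed.

Lemma enorm_le_l1 (R : realType) (d : nat) (x : 'rV[R]_d) : enorm x <= l1 x.
Proof.
rewrite -[leRHS]ger0_norm ?l1_ge0// -sqrtr_sqr /enorm ler_sqrt ?sqr_ge0//.
rewrite expr2 {1}/l1 mulr_suml; apply: ler_sum => i _.
by rewrite -real_normK ?num_real// expr2 ler_wpM2l// coord_le_l1.
Qed.

Lemma l1_le_enorm (R : realType) (d : nat) (x : 'rV[R]_d) :
  l1 x <= d%:R * enorm x.
Proof.
rewrite mulr_natl -[X in _ *+ X]card_ord -sumr_const.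
by apply: ler_sum => i _; exact: coord_le_enorm.
Qed.

Lemma delone_separated (R : realType) (d : nat) (X : set 'rV[R]_d) :
  delone X -> exists r : R, 0 < r /\
    forall x y, X x -> X y -> l1 (x - y) <= d%:R * (2 * r) -> x = y.
Proof.
move=> [r0 [R0 [r00 _ _ sep]]]; exists (r0 / (2 * (d%:R + 1))).
have d1 : 0 < d%:R + 1 :> R by rewrite ltr_wpDl.
split; first by rewrite divr_gt0// mulr_gt0.
move=> x y Xx Xy xy; apply: (sep y) => //; rewrite /eball /=; last first.
  rewrite subrr; apply: le_trans (enorm_le_l1 _) _.
  by rewrite /l1 big1 ?ltW// => i _; rewrite mxE normr0.
apply: le_trans (enorm_le_l1 _) _; apply: le_trans xy _.
have -> : d%:R * (2 * (r0 / (2 * (d%:R + 1)))) = r0 * (d%:R / (d%:R + 1)).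
  by field; rewrite gt_eqF.
by rewrite ler_piMr ?(ltW r00)// ler_pdivrMr// mul1r lerDl.
Qed.

Lemma l1_le (R : realType) (d : nat) (x : 'rV[R]_d) (c : R) :
  (forall i, `|x ord0 i| <= c) -> l1 x <= d%:R * c.
Proof.
move=> h; rewrite mulr_natl -[X in _ *+ X]card_ord -sumr_const.
by apply: ler_sum => i _; exact: h.
Qed.

Section Density.
Context {R : realType} {d : nat} (X : set 'rV[R]_d) (X_delone : delone X).

Lemma finite_box a b : finite_set (X `&` box a b).
Proof.
have [r [r0 sep]] := delone_separated X_delone.
(* [box_induction] requires sides at least [r], so thin and empty boxes are enlarged first. *)
pose b' : 'rV[R]_d := \row_i Num.max (b ord0 i) (a ord0 i + r).
apply: (@sub_finite_set _ _ (X `&` box a b')).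
  move=> x [Xx xab]; split=> // i; have /andP[-> h] := xab i.
  by rewrite mxE lt_max h.
apply: (box_induction (P := fun a b => finite_set (X `&` box a b)) r0).
- move=> {}a {b'} {}b ab.
  have [[x [Xx xab]]|/set0P/negP/negPn/eqP->] := pselect (X `&` box a b !=set0).
    apply: (@sub_finite_set _ _ [set x]) => // y [Xy yab].
    apply: sep => //; apply: l1_le => i; have := xab i; have := yab i;
      have := ab i.
    rewrite !mxE ler_norml => /andP[? ?] /andP[? ?] /andP[? ?].
    by apply/andP; split; lra.
  exact: finite_set0.
- by move=> {}a {b'} {}b i t /box_cut ->; rewrite setIUr finite_setU.
- by move=> i; rewrite mxE; case: (lerP (b ord0 i) (a ord0 i + r)) => ?; lra.
Qed.

Lemma npts_additive : additive_on_boxes (fun a b => npts X (box a b)).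
Proof. by move=> a b i t; apply: npts_box_cut finite_box. Qed.

Lemma npts_ge0 A : 0 <= npts X A. Proof. exact: ler0n. Qed.

Lemma vol_pos (s : R) (a b : 'rV[R]_d) : 0 < s ->
  (forall i, s <= b ord0 i - a ord0 i) -> s ^+ d <= vol a b.
Proof.
move=> s0 h; rewrite -[d in s ^+ d]card_ord -prodr_const.
by apply: ler_prod => i _; rewrite h ltW.
Qed.

Lemma vol_le (s : R) (a b : 'rV[R]_d) :
  (forall i, 0 <= b ord0 i - a ord0 i <= s) -> vol a b <= s ^+ d.
Proof.
move=> h; rewrite -[d in s ^+ d]card_ord -prodr_const.
by apply: ler_prod => i _; rewrite h.
Qed.

Definition density_bounds (s l u : R) :=
  forall a b : 'rV[R]_d, (forall i, s <= b ord0 i - a ord0 i) ->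
    l * vol a b <= npts X (box a b) <= u * vol a b.

Lemma density_bounds_small (s l u : R) : 0 < s ->
  (forall a b : 'rV[R]_d, (forall i, s <= b ord0 i - a ord0 i <= 2 * s) ->
    l * vol a b <= npts X (box a b) <= u * vol a b) ->
  density_bounds s l u.
Proof.
move=> s0 h; apply: (box_induction s0) h _ => a b i t ht.
rewrite (npts_additive ht) (vol_cut a b i t) => /andP[? ?] /andP[? ?].
by apply/andP; split; lra.
Qed.

Lemma density_boundsW (s s' l u : R) :
  s <= s' -> density_bounds s l u -> density_bounds s' l u.
Proof. by move=> ss h a b ab; apply: h => i; apply: le_trans (ab i). Qed.

(** A box with sides between [r] and [2 * r] has volume at least [r ^+ d] and at most one point. A
    box with sides between [4 * R0] and [8 * R0] contains a ball of radius [R0], hence a point. *)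
Lemma initial_density_bounds :
  exists s l u : R, [/\ 0 < s, 0 < l & density_bounds s l u].
Proof.
have [r [r0 sep]] := delone_separated X_delone.
have [_ [R0 [_ R00 dense _]]] := X_delone.
have up : density_bounds r 0 (r ^- d).
  apply: density_bounds_small => // a b ab.
  rewrite mul0r npts_ge0 /=.
  have v : 1 <= r ^- d * vol a b.
    rewrite mulrC ler_pdivlMr ?exprn_gt0// mul1r vol_pos// => i.
    by have /andP[] := ab i.
  apply: le_trans v; rewrite /npts -[leRHS]/1%:R ler_nat.
  have [[x [Xx xab]]|/set0P/negP/negPn/eqP->] := pselect (X `&` box a b !=set0);
    last by rewrite fset_set0 cardfs0.
  have -> : X `&` box a b = [set x].
    apply/seteqP; split=> [y [Xy yab]|y -> //].
    apply: sep => //; apply: l1_le => i; have := xab i; have := yab i;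
      have := ab i.
    rewrite !mxE ler_norml => /andP[? ?] /andP[? ?] /andP[? ?].
    by apply/andP; split; lra.
  by rewrite fset_set1 cardfs1.
have lo : exists l, 0 < l /\ forall a b : 'rV[R]_d, (forall i, 4 * R0 <= b ord0
  i - a ord0 i) ->
    l * vol a b <= npts X (box a b).
  exists ((8 * R0) ^- d); split; first by rewrite invr_gt0 exprn_gt0// mulr_gt0.
  apply: box_induction; first by rewrite mulr_gt0.
    move=> a b ab.
    have [x [Xx ax]] := dense (\row_i (a ord0 i + 2 * R0)).
    have xab : box a b x.
      move=> i; have := le_trans (coord_le_enorm _ i) ax; have := ab i.
      rewrite !mxE ler_norml => /andP[? ?] /andP[? ?].
      by apply/andP; split; lra.
    apply: (@le_trans _ _ 1).
      rewrite mulrC ler_pdivrMr ?exprn_gt0 ?mulr_gt0// mul1r vol_le// => i.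
      by have /andP[? ?] := ab i; apply/andP; split; lra.
    rewrite /npts ler1n cardfs_gt0; apply/fset0Pn; exists x.
    by rewrite in_fset_set ?inE//; exact: finite_box.
  move=> a b i t ht; rewrite (npts_additive ht) (vol_cut a b i t); lra.
have [l [l0 hl]] := lo.
exists (Num.max r (4 * R0)), l, (r ^- d); split=> //;
  first by rewrite lt_max r0.
move=> a b ab; rewrite hl => [|i]; last first.
  by apply: le_trans (ab i); rewrite le_max lexx orbT.
have abr i : r <= b ord0 i - a ord0 i.
  by apply: le_trans (ab i); rewrite le_max lexx.
by have /andP[_ ->] := up a b abr.
Qed.
End Density.

(** * Discrepancy of linearly repetitive sets *)

Lemma npts_translate (R : realType) (d : nat) (X A B : set 'rV[R]_d)
    (v : 'rV[R]_d) : finite_set (X `&` A) ->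
  X `&` B = [set x + v | x in X `&` A] -> npts X B = npts X A.
Proof.
move=> fA e; rewrite /npts e fset_set_image// card_imfset//.
exact: addIr.
Qed.

Lemma box_translate (R : realType) (d : nat) (a b v x : 'rV[R]_d) :
  box (a + v) (b + v) (x + v) <-> box a b x.
Proof. by split=> h i; have := h i; rewrite !mxE lerD2r ltrD2r. Qed.

Lemma vol_translate (R : realType) (d : nat) (a b v : 'rV[R]_d) :
  vol (a + v) (b + v) = vol a b.
Proof. by apply: eq_bigr => i _; rewrite !mxE; ring. Qed.

Section LinearRepetitivity.
Context {R : realType} {d : nat} (X : set 'rV[R]_d) (X_delone : delone X).
Context (X_lr : linearly_repetitive X).

Lemma linear_repeats : exists L : R, 0 < L /\
  forall r, 1 <= r -> repeats_within X r (L * r).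
Proof.
have [rep [L [L0 hL]]] := X_lr.
(* The extra 1 leaves room above the infimum, so that some admissible radius lies below
   [(L + 1) * r]. *)
exists (L + 1); split; first by rewrite addr_gt0.
move=> r r1; have r0 : 0 < r by apply: lt_le_trans r1.
have [M [M0 hM]] : exists M, (0 < M /\ repeats_within X r M) /\ M < (L + 1) * r.
  have [M0 [M00 hM0]] := rep r r0.
  have nonE : [set M : R | 0 < M /\ repeats_within X r M] !=set0 by exists M0.
  have lt : inf [set M : R | 0 < M /\ repeats_within X r M] < (L + 1) * r.
    by apply: le_lt_trans (hL r r1) _; rewrite ltr_pM2r// ltrDl.
  by have [M hM ltM] := inf_lt nonE lt; exists M.
move=> z x Xx; have [_ /(_ z x Xx)[y [Xy zy e]]] := M0.
by exists y; split=> //; apply: le_trans zy _; apply: ltW.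
Qed.

Lemma box_copies : exists M s1 : R, [/\ 8 <= M, 0 < s1
  & forall s (a b A B : 'rV[R]_d), s1 <= s ->
    (forall i, s <= b ord0 i - a ord0 i <= 2 * s) ->
    (forall i, M * s <= B ord0 i - A ord0 i) ->
    exists a' b' : 'rV[R]_d,
      [/\ forall i, [/\ A ord0 i + s <= a' ord0 i, s <= b' ord0 i - a' ord0 i
            & b' ord0 i + s <= B ord0 i],
          vol a' b' = vol a b & npts X (box a' b') = npts X (box a b)]].
Proof.
have [L [L0 hL]] := linear_repeats.
have [_ [R0 [_ R00 dense _]]] := X_delone.
(* The ball of radius [c * s] around [x] has to cover the box: its extent takes [2 * d * s] and the
   distance from [x] to [a] at most [d * s]. The 1 ensures that the radius is at least 1. *)
pose c : R := 3 * d%:R + 1.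
have c1 : 1 <= c by rewrite lerDr mulr_ge0.
have cL : 0 <= L * c by rewrite mulr_ge0 ?ltW//; apply: lt_le_trans c1.
(* The copy is sought near [z], at [M * s / 2] from the lower faces. It misses by [L * c * s] from
   repetitivity and by [s] from the offset of [x]; its sides of at most [2 * s] and the margin [s]
   must fit too. So half of [M] has to be [L * c + 4]. *)
exists (8 + 2 * (L * c)), (Num.max 1 R0).
split; [by rewrite lerDl; lra|by rewrite lt_max ltr01|].
move=> s a b A B; rewrite ge_max => /andP[s1 sR] ab AB.
have s0 : 0 < s by lra.
have [x [Xx ax]] := dense a.
have r1 : 1 <= c * s by nra.
pose z : 'rV[R]_d := \row_i (A ord0 i + (8 + 2 * (L * c)) * s / 2).
have [y [Xy zy rep]] := hL (c * s) r1 z x Xx.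
have inball p : box a b p -> eball x (c * s) p.
  move=> pab; apply: le_trans (enorm_le_l1 _) _.
  have -> : p - x = (p - a) + - (x - a) by rewrite opprB addrA subrK.
  apply: le_trans (l1D _ _) _; rewrite l1N.
  have h1 : l1 (p - a) <= d%:R * (2 * s).
    apply: l1_le => i; rewrite !mxE ler_norml.
    by have /andP[? ?] := pab i; have /andP[? ?] := ab i; apply/andP; split;
      lra.
  have h2 : l1 (x - a) <= d%:R * R0.
    by apply: le_trans (l1_le_enorm _) _; rewrite ler_wpM2l.
  have h3 : d%:R * R0 <= d%:R * s by rewrite ler_wpM2l.
  by rewrite /c; lra.
exists (a + (y - x)), (b + (y - x)); split.
- move=> i; have := le_trans (coord_le_enorm _ i) zy.
  have := le_trans (coord_le_enorm _ i) ax; have := ab i; have := AB i.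
  rewrite !mxE !ler_norml => ? /andP[? ?] /andP[? ?] /andP[? ?].
  have : L * (c * s) = L * c * s by rewrite mulrA.
  by move: (L * c * s) (L * (c * s)) => u v uv; split; lra.
- exact: vol_translate.
- apply: (npts_translate (v := y - x)); first exact: finite_box.
  apply/seteqP; split=> [q [Xq qab]|_ [p [Xp pab] <-]].
    have pq : q = (q - (y - x)) + (y - x) by rewrite subrK.
    have pab : box a b (q - (y - x)) by apply/(box_translate a b (y - x));
      rewrite -pq.
    exists (q - (y - x)); last by rewrite -pq.
    split=> //; have : (X `&` eball y (c * s)) q.
      split=> //; have := inball _ pab; rewrite /eball /=.
      by congr (enorm _ <= _); rewrite opprB addrA addrAC addrK.
    rewrite rep => -[p [Xp _] pE]; suff -> : q - (y - x) = p by [].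
    by rewrite -pE -[p + y - x]addrA addrK.
  split; last exact/box_translate.
  have : (X `&` eball y (c * s)) (p + y - x).
    by rewrite rep; exists p => //; split=> //; exact: inball.
  by rewrite addrA => -[].
Qed.

(* Either some small box has few points, and its copies inside every large box
   lower the upper density, or no small box has, which raises the lower one. *)
Lemma density_bounds_contract : exists M s1 th : R,
  [/\ 1 <= M, 0 < s1, 0 <= th < 1 & forall s l u, s1 <= s -> 0 <= l <= u ->
    density_bounds X s l u -> exists l' u', [/\ l <= l', l' <= u',
      u' - l' <= th * (u - l) & density_bounds X (M * s) l' u']].
Proof.
have [M [s1 [M8 s10 copies]]] := box_copies.
have M0 : 0 < M by lra.
(* A copy of a small box fills at least the share [c] of a large one, as [s ^+ d] compares with
   [(2 * (M * s)) ^+ d]. On it the density falls short of [u] by half the gap; hence the contraction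
   by [1 - c / 2]. *)
pose c := (2 * M) ^- d.
have c0 : 0 < c by rewrite invr_gt0 exprn_gt0// mulr_gt0.
have c1 : c <= 1 by rewrite invf_le1 ?exprn_gt0 ?exprn_ege1//; lra.
exists M, s1, (1 - c / 2); split; [lra|by []|by apply/andP; split; lra|].
move=> s l u s1s /andP[l0 lu] hs; pose m := (l + u) / 2.
have s0 : 0 < s by lra.
have Ms : s <= M * s by nra.
have [[a [b [ab hab]]]|nex] := pselect (exists a b : 'rV[R]_d,
    (forall i, s <= b ord0 i - a ord0 i <= 2 * s) /\
    npts X (box a b) <= m * vol a b).
  exists l, (u - c / 2 * (u - l)); split=> //; [nra|lra|].
  apply: (density_bounds_small X_delone); first by rewrite mulr_gt0.
  move=> A B AB.
  have ABs i : s <= B ord0 i - A ord0 i by apply: le_trans Ms _;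
    have /andP[] := AB i.
  have /andP[-> _] := hs A B ABs; rewrite /=.
  have AB1 i : M * s <= B ord0 i - A ord0 i by have /andP[] := AB i.
  have [a' [b' [sub volE countE]]] := copies s a b A B s1s ab AB1.
  have Dadd : additive_on_boxes (fun a b => u * vol a b - npts X (box a b)).
    move=> x y i t ht; rewrite (vol_cut x y i t) (npts_additive X_delone ht).
    by ring.
  have D0 (x y : 'rV[R]_d) : (forall i, s <= y ord0 i - x ord0 i) ->
      0 <= u * vol x y - npts X (box x y).
    by move=> /hs /andP[_]; rewrite subr_ge0.
  have := box_sub_le (ltW s0) Dadd D0 sub; rewrite volE countE.
  have v1 : s ^+ d <= vol a b by apply: vol_pos => // i; have /andP[] := ab i.
  have v2 : vol A B <= (2 * (M * s)) ^+ d.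
    apply: vol_le => i; have /andP[? ?] := AB i; apply/andP; split; last by [].
    by apply: le_trans (ABs i); apply: ltW.
  have v3 : c * (2 * (M * s)) ^+ d = s ^+ d.
    rewrite mulrA exprMn mulrA mulVf ?mul1r//.
    by rewrite gt_eqF// exprn_gt0// mulr_gt0.
  have v4 : c * vol A B <= vol a b.
    by apply: le_trans v1; rewrite -v3 ler_wpM2l// ltW.
  by move: hab; rewrite /m; nra.
exists m, u; split; [by rewrite /m; lra|by rewrite /m; lra|by rewrite /m; nra|].
apply: (density_boundsW Ms);
  apply: (density_bounds_small X_delone) => // a b ab.
have abs i : s <= b ord0 i - a ord0 i by have /andP[] := ab i.
have /andP[_ ->] := hs a b abs; rewrite andbT leNgt; apply/negP => h.
by apply: nex; exists a, b; split=> //; apply: ltW.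
Qed.

(** Every lower density is at most every upper one ([cmp] tests both on one large cube). So [rho],
    the supremum of the lower ones, lies between the bounds of each scale, whose gap decays
    geometrically. *)
Lemma density_exists : exists rho M s1 th C : R,
  [/\ 0 < rho, 1 <= M, 0 < s1, 0 <= th < 1 /\ 0 <= C &
    forall n (a b : 'rV[R]_d), (forall i, s1 * M ^+ n <= b ord0 i - a ord0 i) ->
      `|npts X (box a b) - rho * vol a b| <= C * th ^+ n * vol a b].
Proof.
have [M [s1 [th [M1 s10 /andP[th0 th1] contract]]]] := density_bounds_contract.
have [s2 [l0 [u0 [s20 l00 h0]]]] := initial_density_bounds X_delone.
pose s := Num.max s1 s2.
have s0 : 0 < s by rewrite lt_max s10.
have M0 : 0 < M by lra.
pose cube (t : R) : 'rV[R]_d := \row_i t.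
have cube_side t i : cube t ord0 i - (0 : 'rV[R]_d) ord0 i = t.
  by rewrite !mxE subr0.
have vol_cube t : vol 0 (cube t) = t ^+ d.
  by rewrite /vol (eq_bigr (fun=> t)) ?prodr_const ?card_ord.
have cmp t l u t' l' u' : 0 < t -> 0 < t' -> density_bounds X t l u ->
    density_bounds X t' l' u' -> l <= u'.
  move=> t0 t0' h h'; pose x := Num.max t t'.
  have x0 : 0 < x by rewrite lt_max t0.
  have /andP[h1 _] : l * vol 0 (cube x) <= npts X (box 0 (cube x)) <= u * vol 0
    (cube x).
    by apply: h => i; rewrite cube_side le_max lexx.
  have /andP[_ h2] : l' * vol 0 (cube x) <= npts X (box 0 (cube x)) <= u' * vol
    0 (cube x).
    by apply: h' => i; rewrite cube_side le_max lexx orbT.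
  have := le_trans h1 h2; rewrite vol_cube ler_pM2r// exprn_gt0//.
have step n : exists l u, [/\ l0 <= l, l <= u, u - l <= (u0 - l0) * th ^+ n &
    density_bounds X (s * M ^+ n) l u].
  elim: n => [|n [l [u [l0l lu ul hn]]]].
    exists l0, u0; rewrite expr0 !mulr1; split=> //;
      first exact: (cmp _ _ _ _ _ _ s20 s20 h0 h0).
    by apply: density_boundsW h0; rewrite le_max lexx orbT.
  have := contract (s * M ^+ n) l u; case.
  - rewrite (@le_trans _ _ s)// ?le_max ?lexx// ler_peMr ?(ltW s0)//.
    exact: exprn_ege1.
  - by rewrite lu (le_trans (ltW l00) l0l).
  - by [].
  move=> l' [u' [ll' lu' ul' h']]; exists l', u'; split=> //.
  - exact: le_trans ll'.
  - apply: le_trans ul' _; rewrite exprS mulrCA ler_wpM2l//.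
  - by rewrite exprS mulrCA.
pose L := [set l : R | exists u n, density_bounds X (s * M ^+ n) l u].
have spos n : 0 < s * M ^+ n by rewrite mulr_gt0// exprn_gt0.
have [l1 [u1 [l01 _ _ h1]]] := step 0%N.
have Lsup : has_sup L.
  split; first by exists l1, u1, 0%N.
  exists u1 => l [u [n h]]; exact: (cmp _ _ _ _ _ _ (spos n) (spos 0%N) h h1).
exists (sup L), M, s, th, (u0 - l0); split=> //.
- by apply: (lt_le_trans l00); apply: le_trans l01 _;
  apply: sup_upper_bound => //; exists u1, 0%N.
- by split; [rewrite th0|rewrite subr_ge0;
  exact: (cmp _ _ _ _ _ _ s20 s20 h0 h0)].
move=> n a b ab; have [l [u [l0l lu ul hn]]] := step n.
have ll : l <= sup L by apply: sup_upper_bound => //; exists u, n.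
have uu : sup L <= u.
  by apply: ge_sup; [case: Lsup|move=> x [v [k h]];
    exact: (cmp _ _ _ _ _ _ (spos k) (spos n) h hn)].
have /andP[g1 g2] := hn a b ab.
have v0 : 0 <= vol a b.
  by apply: le_trans (vol_pos (spos n) ab); rewrite exprn_ge0// ltW.
rewrite ler_norml; apply/andP; split.
  by nra.
by nra.
Qed.

End LinearRepetitivity.

Lemma bernoulli_le (R : realType) (x : R) (n : nat) :
  0 <= x <= 1 -> 1 - n%:R * x <= (1 - x) ^+ n.
Proof.
move=> /andP[x0 x1]; elim: n => [|n IH]; first by rewrite mul0r subr0 expr0.
have : (1 - x) * (1 - n%:R * x) <= (1 - x) * (1 - x) ^+ n.
  by rewrite ler_wpM2l// subr_ge0.
rewrite -exprS -[n.+1]addn1 natrD.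
have : 0 <= n%:R * x * x by rewrite !mulr_ge0.
lra.
Qed.

Lemma exists_pow2_ge (R : realType) (x : R) : exists n, x <= 2 ^+ n.
Proof.
exists (Num.bound `|x|); apply: le_trans (ler_norm x) _.
apply: ltW; apply: lt_le_trans (archi_boundP (normr_ge0 x)) _.
by rewrite -natrX ler_nat ltnW// ltn_expl.
Qed.

(** The rate is re-expressed in the number [k] of cyclic doublings. [rho] precedes [lam], because
    [lam] will be computed from [rho]. *)
Lemma discrepancy (R : realType) (d' : nat) (X : set 'rV[R]_d'.+1) :
  delone X -> linearly_repetitive X -> exists rho : R, 0 < rho /\
    forall lam : R, 0 < lam -> exists (k1 : nat) (C eta : R),
      [/\ 0 <= C, 0 < eta < 1 & forall k (a b : 'rV[R]_d'.+1), (k1 <= k)%N ->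
        (forall i, lam * 2 ^+ (k %/ d'.+1) <= b ord0 i - a ord0 i) ->
        `|npts X (box a b) - rho * vol a b| <= C * eta ^+ k * (rho * vol a b)].
Proof.
move=> Xd Xlr.
have [rho [M [s1 [th [C [rho0 M1 s10 [/andP[th0 th1] C0] H]]]]]] :=
  density_exists Xd Xlr.
exists rho; split=> // lam lam0.
have [m' hm] := exists_pow2_ge M; have [m0 hm0] := exists_pow2_ge (s1 / lam).
pose m := m'.+1; have {}hm : M <= 2 ^+ m.
  by apply: le_trans hm _; rewrite ler_weXn2l// ?leqnSn// ler1n.
rewrite ler_pdivrMr// mulrC in hm0.
pose D := d'.+1; pose N := (m * D)%N.
have N0 : 0 < N%:R :> R by rewrite ltr0n muln_gt0.
have N1 : 1 <= N%:R :> R by rewrite ler1n muln_gt0.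
(* A contraction by [th] spans [m] doublings of every side, that is [N] steps. By Bernoulli's
   inequality [(1 - x) ^+ N] is at least (1 + th) / 2, hence at least [th]. *)
pose x := (1 - th) / (2 * N%:R).
have x0 : 0 < x by rewrite divr_gt0 ?subr_gt0// mulr_gt0.
have Nx : N%:R * x = (1 - th) / 2 by rewrite /x; field; rewrite gt_eqF.
have x1 : x <= 1 / 2.
  have : x <= N%:R * x by rewrite ler_peMl// ltW.
  by rewrite Nx; lra.
pose eta := 1 - x.
have eta0 : 0 < eta by rewrite /eta; lra.
have theta : th <= eta ^+ N.
  apply: le_trans (bernoulli_le N _); last by apply/andP; split; lra.
  by rewrite Nx; lra.
(* Steps lost to the starting scale [m0] and to the two roundings in [q] and [n]; dividing the
   constant by [eta ^+ K0] compensates for them. *)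
pose K0 := (D * (m0 + m + 1))%N.
exists (D * m0)%N, (C / (rho * eta ^+ K0)), eta; split.
- by rewrite divr_ge0// mulr_ge0 ?exprn_ge0// ltW.
- by rewrite eta0 /eta; lra.
move=> k a b k1 ab.
pose q := (k %/ D)%N; pose n := ((q - m0) %/ m)%N.
have qm0 : (m0 <= q)%N by rewrite leq_divRL// mulnC.
have kN : (k <= N * n + K0)%N.
  have h1 : (k < D * q.+1)%N by rewrite mulnC -ltn_divLR.
  have h2 : (q - m0 < m * n.+1)%N by rewrite mulnC -ltn_divLR.
  have h3 : (q <= m0 + m * n + m)%N.
    by rewrite -addnA [(m * n + m)%N]addnC -mulnS -leq_subLR ltnW.
  apply: leq_trans (ltnW h1) _.
  have -> : (N * n + K0 = D * (m0 + m * n + m + 1))%N.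
    rewrite /N /K0 [(m * D)%N]mulnC -mulnA -mulnDr; congr (D * _)%N.
    by rewrite addnA addnA [(m * n + _)%N]addnC.
  by rewrite leq_mul2l addn1 ltnS h3 orbT.
have sideH i : s1 * M ^+ n <= b ord0 i - a ord0 i.
  apply: le_trans (ab i);
    apply: (@le_trans _ _ (lam * 2 ^+ m0 * (2 ^+ m) ^+ n)).
    apply: ler_pM => //; first exact: ltW.
      by rewrite exprn_ge0//; lra.
    by apply: lerXn2r => //; rewrite nnegrE; lra.
  rewrite -mulrA ler_pM2l// -exprM -exprD ler_weXn2l ?ler1n//.
  have h2 : (m * n <= q - m0)%N by rewrite mulnC leq_trunc_div.
  by rewrite -(leq_add2l m0) subnKC// in h2.
apply: le_trans (H n a b sideH) _.
have v0 : 0 <= vol a b.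
  apply: prodr_ge0 => i _; apply: le_trans (sideH i).
  by rewrite mulr_ge0 ?(ltW s10)// exprn_ge0//; lra.
have -> : C / (rho * eta ^+ K0) * eta ^+ k * (rho * vol a b)
    = C * (eta ^+ k / eta ^+ K0) * vol a b.
  by field; rewrite !gt_eqF// exprn_gt0.
rewrite ler_wpM2r// ler_wpM2l// ler_pdivlMr ?exprn_gt0//.
apply: (@le_trans _ _ (eta ^+ (N * n) * eta ^+ K0)).
  rewrite ler_wpM2r ?exprn_ge0 ?(ltW eta0)// exprM.
  by apply: lerXn2r => //; rewrite nnegrE// exprn_ge0// ltW.
rewrite -exprD ler_wiXn2l ?(ltW eta0)//; rewrite /eta; lra.
Qed.

(** * From the Delone set to the lattice *)

Lemma transport_total (R : realType) (S T : eqType) (E : S -> T -> Prop)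
    (f : S -> R) (g : T -> R) p :
  transport E f g -> 0 < f p -> exists q, E p q.
Proof.
move=> [_ _ h _] fp; apply: contrapT => nex.
have := h [:: p] [::] isT isT; rewrite big_seq1 big_nil leNgt fp => H.
suff : false by []. apply: H => q r; rewrite inE => /eqP-> pr.
by exfalso; apply: nex; exists r.
Qed.

Lemma shift_transport (R : realType) (d : nat) (z0 : 'rV[int]_d) (c : R) :
  0 <= c -> exists E, transport E (fun=> c) (fun=> c) /\
    (forall z z' : 'rV[int]_d, E z z' -> z' = z - z0) /\ (0 < c -> E z0 0).
Proof.
move=> c0; pose w (z z' : 'rV[int]_d) := c * (z' == z - z0)%:R.
have wP z z' : 0 < w z z' -> z' = z - z0.
  by rewrite /w; case: eqP => // _; rewrite mulr0 ltxx.
exists (fun z z' => 0 < w z z'); split; last first.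
  by split=> // cp; rewrite /w subrr eqxx mulr1.
apply: coupling_transport; first by move=> z z'; rewrite mulr_ge0.
  move=> z; exists [:: z - z0]; split=> // [z' /wP->|]; first exact: mem_head.
  by rewrite big_seq1 /w eqxx mulr1.
move=> z'; exists [:: z' + z0]; split=> // [z /wP->|].
  by rewrite subrK mem_head.
by rewrite big_seq1 /w addrK eqxx mulr1.
Qed.

Section Cells.
Context {R : realType} {d : nat} (X : set 'rV[R]_d) (X_delone : delone X).
Context (h : R) (h0 : 0 < h) (m : R) (m0 : 0 <= m).

Definition cell (x : 'rV[R]_d) : 'rV[int]_d :=
  \row_i Num.floor (x ord0 i / h).

Definition corner (q : 'rV[int]_d) : 'rV[R]_d := \row_i (h * (q ord0 i)%:~R).

Lemma cellP x q : cell x = q <-> box (corner q) (corner (q + const_mx 1)) x.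
Proof.
split=> [<- i|hx].
  rewrite !mxE mulrC -ler_pdivlMr// floor_le /=.
  by rewrite mulrC -ltr_pdivrMr// floorD1_gt.
apply/rowP => i; rewrite mxE; apply: floor_def.
have := hx i; rewrite !mxE.
by rewrite ler_pdivlMr// ltr_pdivrMr// ![_ * h]mulrC.
Qed.

Lemma cell_transport : exists E,
  transport E (fun x => m * (`[< X x >])%:R)
    (fun q => m * npts X (box (corner q) (corner (q + const_mx 1)))) /\
  (forall x q, E x q -> X x) /\
  quasi_isometric (fun x x' => l1 (x - x') / h) (@dist1 R d) E 1 d%:R.
Proof.
pose w (x : 'rV[R]_d) (q : 'rV[int]_d) : R := m * (`[< X x >] && (cell x ==
  q))%:R.
have wP x q : 0 < w x q -> X x /\ cell x = q.
  rewrite /w; case: asboolP => Xx; last by rewrite mulr0 ltxx.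
  by case: eqP => //=; rewrite mulr0 ltxx.
exists (fun x q => 0 < w x q); split; [|split].
- apply: coupling_transport; first by move=> x q; rewrite mulr_ge0.
    move=> x; exists [:: cell x]; split=> // [q /wP[_ ->]|];
      first exact: mem_head.
    by rewrite big_seq1 /w eqxx andbT.
  move=> q; set A := box _ _.
  have fA : finite_set (X `&` A)%classic by exact: finite_box.
  exists (enum_fset (fset_set (X `&` A)%classic)); split.
  + exact: fset_uniq.
  + move=> x /wP[Xx /cellP xA]; rewrite in_fset_set// inE; split=> //.
  + rewrite /npts -big_distrr /=; congr (m * _).
    rewrite big_seq (eq_bigr (fun=> 1)) => [|x].
      by rewrite -big_seq big_const_seq count_predT iter_addr_0.
    rewrite in_fset_set// inE => -[Xx xA].
    by rewrite asboolT//=; have /cellP -> := xA; rewrite eqxx.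
- by move=> x q /wP[].
move=> x q x' q' /wP[_ <-] /wP[_ <-]; rewrite !mul1r.
have E1 : d%:R = \sum_(i < d) 1 :> R by rewrite sumr_const card_ord.
have E2 : dist1 R (cell x) (cell x') = \sum_(i < d) `|(cell x ord0 i - cell x'
  ord0 i)%:~R|.
  rewrite /dist1 /l1 rmorph_sum; apply: eq_bigr => i _.
  by rewrite /= !mxE intr_norm.
have E3 : l1 (x - x') / h = \sum_(i < d) `|x ord0 i / h - x' ord0 i / h|.
  rewrite /l1 mulr_suml; apply: eq_bigr => i _.
  by rewrite !mxE -mulrBl normrM [ `|h^-1| ]gtr0_norm ?invr_gt0.
rewrite E1 E2 E3 -!big_split /=.
have fl (y : R) : (Num.floor y)%:~R <= y < (Num.floor y)%:~R + 1.
  by rewrite floor_le /=; have := floorD1_gt y; rewrite intrD.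
split; apply: ler_sum => i _; rewrite !mxE intrB;
  have /andP[? ?] := fl (x ord0 i / h); have /andP[? ?] := fl (x' ord0 i / h).
  have := ler_norm (x ord0 i / h - x' ord0 i / h).
  have := ler_norm (x' ord0 i / h - x ord0 i / h).
  by rewrite distrC => ? ?; rewrite ler_norml; apply/andP; split; lra.
set u := (Num.floor (x ord0 i / h))%:~R;
  set v := (Num.floor (x' ord0 i / h))%:~R.
have := ler_norm (u - v); have := ler_norm (v - u).
by rewrite distrC /u /v => ? ?; rewrite ler_norml; apply/andP; split; lra.
Qed.

End Cells.

(** This makes [discrepancy] applicable to smoothed densities: each averaging joins the counts of
    two adjacent boxes. *)
Lemma smooth_npts (R : realType) (d' : nat) (X : set 'rV[R]_d'.+1) (h m : R)
    (k : nat) (q : 'rV[int]_d'.+1) : delone X -> 0 < h ->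
  smooth k (fun q => m * npts X (box (corner h q) (corner h (q + const_mx 1))))
    q
  = m / \prod_(i < d'.+1) (side k i)%:R *
    npts X (box (corner h (q + const_mx 1 - \row_i (side k i)%:Z))
                 (corner h (q + const_mx 1))).
Proof.
move=> Xd h0; elim: k q => [|k IH] q.
  rewrite /= big1 => [|i _]; last by rewrite side0.
  rewrite divr1; congr (_ * npts X (box (corner h _) _)).
  by apply/rowP => i; rewrite !mxE side0 addrK.
pose j := axis d' k; pose s := (2 ^ (k %/ d'.+1))%N.
have sj : side k j = s by exact: side_axis.
rewrite /= /avg !IH -/j -/s.
have -> : \prod_(i < d'.+1) (side k.+1 i)%:R = 2 * \prod_(i < d'.+1) (side k
  i)%:R :> R.
  rewrite (bigD1 j)//= [in RHS](bigD1 j)//= sideS eqxx natrM -!mulrA.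
  congr (_ * (_ * _)); apply: eq_bigr => i /negPf ij.
  by rewrite sideS -/j ij.
have p0 : 0 < \prod_(i < d'.+1) (side k i)%:R :> R.
  by apply: prodr_gt0 => i _; rewrite ltr0n expn_gt0.
set b := corner h (q + const_mx 1).
set a := corner h (q + const_mx 1 - \row_i (side k.+1 i)%:Z).
pose t : R := h * (q ord0 j + 1 - s%:Z)%:~R.
have sk i : side k.+1 i = if i == j then (2 * s)%N else side k i.
  by rewrite sideS -/j; case: eqP => [->|//]; rewrite sj.
rewrite (@npts_additive _ _ X Xd a b j t); last first.
  rewrite /a /b /t !mxE sk eqxx !ler_pM2l// !ler_int.
  by move: (q ord0 j) (s) => u v; apply/andP; split; lia.
have -> : corner h (q + const_mx 1 - \row_i (side k i)%:Z) = setc a j t.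
  apply/rowP => i; have [->|ij] := eqVneq i j.
    by rewrite setc_eq !mxE sj.
  by rewrite setc_neq// !mxE sk (negPf ij).
have -> : corner h (q - s%:Z *: evec j + const_mx 1) = setc b j t.
  apply/rowP => i; have [->|ij] := eqVneq i j.
    by rewrite setc_eq !mxE !eqxx mulr1 /t; congr (_ * _%:~R);
      move: (q ord0 j) (s) => u v; lia.
  by rewrite setc_neq// !mxE (negPf ij) andbF mulr0 subr0.
have -> : corner h (q - s%:Z *: evec j + const_mx 1 - \row_i (side k i)%:Z) = a.
  apply/rowP => i; rewrite !mxE sk; have [->|ij] := eqVneq i j.
    by rewrite !eqxx mulr1 sj; congr (_ * _%:~R); move: (q ord0 j) (s) => u v;
      lia.
  by rewrite andbF mulr0 subr0.
by field; rewrite gt_eqF.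
Qed.

Lemma exists_expr_le (R : realType) (eta del : R) (k1 : nat) :
  0 < eta < 1 -> 0 < del -> exists2 k, (k1 <= k)%N & eta ^+ k <= del.
Proof.
move=> /andP[eta0 eta1] del0.
have eta_norm : `|eta| < 1 by rewrite gtr0_norm.
have /cvgr0Pnorm_lt /(_ del del0) [N _ hN] := cvg_expr eta_norm.
exists (maxn k1 N); first exact: leq_maxl.
apply: ltW; apply: le_lt_trans (ler_norm _) _.
by apply: hN; rewrite /= leq_maxr.
Qed.

Lemma geometric_tail (R : realType) (eta : R) (c k0 n : nat) :
  0 < eta < 1 -> (c <= k0)%N ->
  \sum_(k0 <= k < k0 + n) eta ^+ (k - c) <= eta ^+ (k0 - c) / (1 - eta).
Proof.
move=> /andP[eta0 eta1] ck; rewrite ler_pdivlMr ?subr_gt0//.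
suff : (\sum_(k0 <= k < k0 + n) eta ^+ (k - c)) * (1 - eta)
    <= eta ^+ (k0 - c) - eta ^+ (k0 + n - c).
  by move=> /le_trans; apply; rewrite gerBl exprn_ge0// ltW.
elim: n => [|n IH]; first by rewrite addn0 big_geq// mul0r subrr.
rewrite addnS big_nat_recr ?leq_addr//= subSn;
  last by rewrite (leq_trans ck)// leq_addr.
rewrite exprS; lra.
Qed.

(** [K] and [C] are fixed before [W], whereas mesh, mass and number of steps depend on [W]. The base
    pair [x0], 0 confines the partners of each point to a ball independent of [W]. *)
Lemma window_relation (R : realType) (d' : nat) (X : set 'rV[R]_d'.+1)
    (x0 : 'rV[R]_d'.+1) : delone X -> linearly_repetitive X -> X x0 ->
  exists K C : R, [/\ 0 < K, 0 <= C & forall W : R,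
    exists (m : R) (S : 'rV[R]_d'.+1 -> 'rV[int]_d'.+1 -> Prop),
      [/\ 0 < m, transport S (fun x => m * (`[< X x >])%:R) (fun=> m),
          S x0 0, forall x z, S x z -> X x &
          forall x z x' z', S x z -> S x' z' -> l1 (x' - x0) <= W ->
            dist1 R z z' <= K * l1 (x - x') + C /\
            l1 (x - x') <= K * dist1 R z z' + C]].
Proof.
have aux (a b c k : nat) : (b <= k)%N -> (c <= 1)%N -> (a + b + c <= k.+1 +
  a)%N.
  by lia.
move=> Xd Xlr Xx0; pose D := d'.+1.
have [rho [rho0 disc]] := discrepancy Xd Xlr.
(* Cubes of side [lam] contain one point of [X] on average. *)
have [lam [lam0 rholam]] : exists lam : R, 0 < lam /\ rho * lam ^+ D = 1.
  exists (rho `^ (- D%:R^-1)); split; first exact: powR_gt0.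
  rewrite -powR_mulrn ?powR_ge0// -powRrM mulNr mulVf ?pnatr_eq0//.
  by rewrite powR_inv1 ?ltW// mulfV ?gt_eqF.
have [k1 [C [eta [C0 etab H]]]] := disc lam lam0.
have /andP[eta0 eta1] := etab.
have [c c0 cE] : exists2 c : R, 0 < c & c = 264 by exists 264;
  [lra|reflexivity].
have [k2 k12 hk2] : exists2 k, (k1 <= k)%N & c * (C * eta ^+ k / (1 - eta)) <=
  1.
  have [|k k1k hk] := @exists_expr_le R eta ((1 - eta) / (c * (C + 1))) k1 etab.
    by rewrite divr_gt0 ?subr_gt0// mulr_gt0// ltr_wpDl.
  exists k => //; rewrite mulrA ler_pdivrMr ?subr_gt0// mul1r.
  move: hk; rewrite ler_pdivlMr ?mulr_gt0 ?ltr_wpDl//.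
  have ek : 0 <= eta ^+ k by rewrite exprn_ge0// ltW.
  have : 0 <= c * eta ^+ k by rewrite mulr_ge0// ltW.
  lra.
(* Additive errors in units of [T] cells: rounding to cells, the coarse chain and the fine chain. *)
pose C1 : R := D%:R + 8 * D%:R * 2 ^+ k2 + 24.
have C10 : 0 <= C1 by rewrite !addr_ge0 ?mulr_ge0 ?exprn_ge0.
pose K := 4 / lam + 4 * lam.
pose C2 : R := 4 * C1 + 24 + D%:R + lam * (2 * C1 + 4 * D%:R + 48).
have D0 : 0 <= D%:R :> R by [].
exists K, C2; split.
- by rewrite addr_gt0 ?divr_gt0 ?mulr_gt0.
- by rewrite !addr_ge0 ?mulr_ge0 ?addr_ge0 ?mulr_ge0// ltW.
move=> W.
(* The fine chain will double every side [n1] times, so that the window ends up within half the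
   final side of the base hyperplane (see [win]). The 4 is the 2 of [lipF] times the 2 of [Q]. *)
have [n1 hn1] := exists_pow2_ge (4 * (W / lam + C1)).
(* Each of the [n] double averagings may cost 24 cells: with a mesh below [1 / n]
   the total stays bounded. *)
pose n := (D * n1)%N; pose T := (2 ^ n)%N; pose h := lam / T%:R.
have T0 : 0 < T%:R :> R by rewrite ltr0n expn_gt0.
have nT : n%:R <= T%:R :> R by rewrite ler_nat ltnW// ltn_expl.
have T1 : 1 <= T%:R :> R by rewrite ler1n expn_gt0.
have h0 : 0 < h by rewrite divr_gt0.
(* With this mass per point the mean mass of a cell, [rho * m * h ^+ D], is 1, and a cube of [T ^ D]
   cells weighs as much as one point. *)
pose m : R := T%:R ^+ D.
have m0 : 0 < m by rewrite exprn_gt0.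
pose f0 (q : 'rV[int]_D) : R := m * npts X (box (corner h q) (corner h (q +
  const_mx 1))).
have f00 q : 0 <= f0 q by rewrite mulr_ge0 ?npts_ge0// ltW.
(* [n * D] steps lead from the mesh to cubes of side [lam]; [k2] more reach the scale from which the
   discrepancies sum to at most 1 / 264. *)
pose k0 := (n * D + k2)%N; pose e k := C * eta ^+ (k - n * D).
have kq k : (k0 <= k)%N -> (k %/ D = n + (k - n * D) %/ D)%N.
  move=> hk; have nk : (n * D <= k)%N by rewrite (leq_trans _ hk)// leq_addr.
  by rewrite -{1}(subnKC nk) divnMDl.
have close k p : (k0 <= k)%N -> `|smooth k f0 p - 1| <= e k.
  move=> hk; rewrite smooth_npts//.
  set a := corner h (p + _ - _); set b := corner h _; set Pi := \prod_(i < _) _.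
  have Pi0 : 0 < Pi by apply: prodr_gt0 => i _; rewrite ltr0n expn_gt0.
  have ab i : b ord0 i - a ord0 i = h * (side k i)%:R.
    by rewrite /a /b !mxE -mulrBr -intrB opprB subrKC.
  have volE : vol a b = h ^+ D * Pi.
    rewrite /vol (eq_bigr (fun i => h * (side k i)%:R)) => [|i _];
      last exact: ab.
    by rewrite big_split /= prodr_const card_ord.
  have unit : m / Pi * (rho * vol a b) = 1.
    rewrite volE /h expr_div_n -/m -rholam.
    by field; rewrite !gt_eqF.
  have -> : m / Pi * npts X (box a b) - 1
      = m / Pi * (npts X (box a b) - rho * vol a b).
    by rewrite mulrBr unit.
  rewrite normrM gtr0_norm ?divr_gt0//.
  apply: (@le_trans _ _ (m / Pi * (e k * (rho * vol a b)))); last first.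
    by rewrite mulrCA unit mulr1.
  rewrite ler_pM2l ?divr_gt0//; apply: H.
    have nk : (n * D <= k)%N by apply: leq_trans hk; rewrite leq_addr.
    by rewrite leq_subRL//; apply: leq_trans hk; rewrite leq_add2l.
  move=> i; rewrite ab /h.
  have -> : lam / T%:R * (side k i)%:R = lam * ((side k i)%:R / T%:R) by ring.
  rewrite ler_pM2l// ler_pdivlMr// -natrX -natrM ler_nat /T -expnD addnC.
  by rewrite -kq// side_ge.
have [E0 [t0 [E0X q0]]] := @cell_transport R D X Xd h h0 m (ltW m0).
have [E1 [t1 q1]] := chain_coarse k0 f00.
have esum : c * \sum_(k0 <= k < k0 + n) e k <= 1.
  apply: le_trans hk2; rewrite ler_pM2l// /e -mulr_sumr -mulrA ler_wpM2l//.
  have -> : k2 = (k0 - n * D)%N by rewrite /k0 addnC addnK.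
  by apply: geometric_tail etab _; rewrite leq_addr.
rewrite cE in esum; have [E2 [t2 q2]] := chain_fine_le2 f00 close esum.
pose kf := (k0 + n)%N; pose F := smooth kf (smooth kf f0).
have closeF p : `|F p - 1| <= e kf.
  by apply: smooth2_close => q; apply: close; rewrite leq_addr.
have lipF := smooth2_lipschitz (fun q => close kf q (leq_addr _ _)).
have ekf0 : 0 <= e kf by rewrite mulr_ge0// exprn_ge0// ltW.
have ekf : c * e kf <= 1.
  apply: le_trans hk2; rewrite ler_pM2l// /e -mulrA ler_wpM2l//.
  rewrite ler_pdivlMr ?subr_gt0//.
  have h1 : eta ^+ (kf - n * D) <= eta ^+ k2.
    apply: ler_wiXn2l; rewrite ?(ltW eta0) ?(ltW eta1)//.
    by rewrite /kf /k0 -addnA addnC addnK leq_addr.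
  have : 0 <= eta ^+ (kf - n * D) by rewrite exprn_ge0// ltW.
  nra.
pose j : 'I_D := ord0.
have t01 := transport_comp t0 t1.
have t012 := transport_comp t01 t2.
have fx0 : 0 < m * (`[< X x0 >])%:R by rewrite asboolT// mulr1.
have [p0 xp0] := transport_total t012 fx0.
pose s : R := (2 ^ (kf %/ D))%N%:R.
have s0 : 0 < s by rewrite ltr0n expn_gt0.
have l0 : 0 <= 2 * e kf / s by apply: divr_ge0; [exact: mulr_ge0|exact: ltW].
have e6 : 6 * e kf <= 1 / 2 by rewrite cE in ekf; clear -ekf ekf0; lra.
(* The flattening is normalised on the hyperplane through [p0], a partner of the base point [x0]. *)
have [E3 [t3 q3]] := flatten_transport j (p0 ord0 j) l0 e6 closeF lipF.
have Tn0 : (0 < T)%N by rewrite expn_gt0.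
have [E4 [t4 q4]] := @block_transport R D T Tn0.
have Fp0 : 0 < F p0.
  by have := closeF p0; rewrite ler_norml => /andP[g1 g2]; clear -g1 g2 e6; lra.
have [z0 pz0] := transport_total (transport_comp t3 t4) Fp0.
have [E5 [t5 [E5z E5z0]]] := shift_transport z0 (ltW m0).
exists m, (rcomp (rcomp (rcomp (rcomp E0 E1) E2) (rcomp E3 E4)) E5); split=> //.
- exact: transport_comp (transport_comp t012 (transport_comp t3 t4)) t5.
- by exists z0; [exists p0|exact: E5z0].
- by move=> x z [y [q [r [p /E0X]]]].
move=> x z x' z' [y [p xp [q pq qy]] yz] [y' [p' xp' [q' pq' qy']] yz'] xW.
have -> : dist1 R z z' = dist1 R y y'.
  by rewrite (E5z _ _ yz) (E5z _ _ yz') /dist1 opprB subrKA.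
pose dX (u v : 'rV[R]_D) := l1 (u - v) / h.
have kfE : (kf %/ D = n + (k2 + n) %/ D)%N.
  rewrite (kq kf (leq_addr _ _)); congr (_ + _ %/ _)%N.
  by rewrite /kf /k0 -addnA addnC addnK.
have sideT : 4 * \sum_(i < D) (side k0 i)%:R <= 8 * D%:R * 2 ^+ k2 * T%:R :> R.
  have sideB (i : 'I_D) : (side k0 i)%:R <= 2 * 2 ^+ k2 * T%:R :> R.
    rewrite -natrX -!natrM ler_nat /T -expnS -expnD leq_exp2l//.
    rewrite -/D (kq k0 (leqnn _)) {2}/k0 addKn.
    by apply: aux; [exact: leq_div|exact: leq_b1].
  have : \sum_(i < D) (side k0 i)%:R <= \sum_(i < D) (2 * 2 ^+ k2 * T%:R) :> R.
    by apply: ler_sum => i _; exact: sideB.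
  by rewrite sumr_const card_ord -mulr_natl; lra.
have Q u v u' v' : rcomp (rcomp E0 E1) E2 u v -> rcomp (rcomp E0 E1) E2 u' v' ->
    dist1 R v v' <= 2 * (dX u u' + C1 * T%:R) /\
    dX u u' <= 2 * (dist1 R v v' + C1 * T%:R).
  have S0 : 0 <= 4 * \sum_(i < D) (side k0 i)%:R :> R.
    by apply: mulr_ge0 => //; apply: sumr_ge0.
  have n0 : 0 <= 24 * n%:R :> R by exact: mulr_ge0.
  have DS0 : 0 <= D%:R + 4 * \sum_(i < D) (side k0 i)%:R :> R by exact:
    addr_ge0.
  have q01 := quasi_isometric_comp (lexx 1) (lexx 1) D0 S0 q0 q1.
  rewrite mulr1 in q01.
  have q012 := quasi_isometric_comp (lexx 1) (ler1n R 2) DS0 n0 q01 q2.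
  rewrite mul1r in q012.
  move=> uv uv'; have [B1 B2] := q012 _ _ _ _ uv uv'.
  have CT : D%:R + 4 * \sum_(i < D) (side k0 i)%:R + 24 * n%:R <= C1 * T%:R.
    have -> : C1 * T%:R = D%:R * T%:R + 8 * D%:R * 2 ^+ k2 * T%:R + 24 * T%:R.
      by rewrite /C1; ring.
    apply: lerD; last by rewrite ler_wpM2l.
    by apply: lerD => //; rewrite ler_peMr.
  split; [apply: le_trans B1 _|apply: le_trans B2 _];
    by rewrite ler_wpM2l// lerD2l.
have [A1 A2] := Q _ _ _ _ xp xp'.
have [W1 _] := Q _ _ _ _ xp' xp0.
have dXE u v : dX u v = l1 (u - v) * T%:R / lam.
  by rewrite /dX /h invf_div mulrA.
have win : `|p' ord0 j - p0 ord0 j|%:~R * (2 * e kf / s) <= e kf.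
  have h1 : `|p' ord0 j - p0 ord0 j|%:~R <= dist1 R p' p0.
    by rewrite ler_int; have := coord_le_l1 (p' - p0) j; rewrite !mxE.
  have h2 : T%:R * 2 ^+ n1 <= s.
    rewrite /s kfE /T -natrX -natrM -expnD ler_nat leq_exp2l// leq_add2l.
    by rewrite leq_divRL// mulnC leq_addl.
  have h3 : dX x' x0 <= W / lam * T%:R.
    by rewrite dXE mulrAC ler_pM2r// ler_pM2r ?invr_gt0.
  have h4 : 4 * (W / lam + C1) * T%:R <= 2 ^+ n1 * T%:R by rewrite ler_pM2r.
  have -> : `|p' ord0 j - p0 ord0 j|%:~R * (2 * e kf / s)
      = (2 * `|p' ord0 j - p0 ord0 j|%:~R / s) * e kf by ring.
  apply: ler_piMl => //; rewrite ler_pdivrMr// mul1r.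
  by clear -h1 h2 h3 h4 W1; lra.
have [A3 A4] := q3 _ _ _ _ pq pq' win.
have [A5 A6] := q4 _ _ _ _ qy qy'.
move: A5 A6; rewrite !mul1r => A5 A6.
have e12 : 1 + 12 * e kf <= 2 by clear -e6; lra.
have dp0 := dist1_ge0 R p p'; have dq0 := dist1_ge0 R q q'.
have dy0 := dist1_ge0 R y y'; have lx0 := l1_ge0 (x - x').
have A3' : dist1 R q q' <= 2 * (dist1 R p p' + 12).
  by apply: le_trans A3 _; rewrite ler_wpM2r// addr_ge0.
have A4' : dist1 R p p' <= 2 * (dist1 R q q' + 12).
  by apply: le_trans A4 _; rewrite ler_wpM2r// addr_ge0.
move: A1 A2; rewrite dXE => A1 A2.
have v0 : 0 < lam^-1 by rewrite invr_gt0.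
have B1 : dist1 R y y' <= 4 * (l1 (x - x') / lam) + (4 * C1 + D%:R + 24).
  by rewrite -(ler_pM2l T0); clear -A1 A3' A5 T1; lra.
have B2 : l1 (x - x') / lam <= 4 * dist1 R y y' + (4 * D%:R + 48 + 2 * C1).
  by rewrite -(ler_pM2l T0); clear -A2 A4' A6 T1; lra.
have LL : 0 <= lam * l1 (x - x') by rewrite mulr_ge0// ltW.
have YY : 0 <= dist1 R y y' / lam by rewrite mulr_ge0// ltW.
split; rewrite /K /C2.
  have : 0 <= lam * (2 * C1 + 4 * D%:R + 48).
    apply: mulr_ge0; first exact: ltW.
    by clear -C10 D0; lra.
  by clear -B1 LL C10 D0; lra.
rewrite ler_pdivrMr// in B2.
by clear -B2 YY v0 lx0 C10 D0; lra.
Qed.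

Lemma separated_within_continuous (R : realType) (d : nat) (A : set 'rV[R]_d)
    (del : R) (f : 'rV[R]_d -> 'rV[R]_d) : 0 < del ->
  (forall x y, A x -> A y -> l1 (x - y) <= d%:R * del -> x = y) ->
  {within A, continuous f}.
Proof.
move=> del0 sep; apply/subspace_continuousP => x Ax; apply: cvg_near_cst.
rewrite /within /=; apply: filterS (nbhsx_ballx x del del0) => y xy Ay.
congr f; apply: sep => //; apply: l1_le => i.
by rewrite !mxE distrC; have [_ h] := xy; have := h ord0 i;
  rewrite /ball /= => /ltW.
Qed.

Lemma int_ball_finite (R : realType) (d : nat) (b : R) :
  exists s : seq 'rV[int]_d, forall z, dist1 R z 0 <= b -> z \in s.
Proof.
pose n := (Num.bound b); pose N := n.*2.+1.
pose v (t : 'rV['I_N]_d) : 'rV[int]_d := \row_i ((t ord0 i : nat)%:Z - n%:Z).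
exists [seq v t | t <- enum {: 'rV['I_N]_d}] => z zb.
have zi i : `|z ord0 i| <= n%:Z.
  have b0 : 0 <= b by apply: le_trans zb; exact: dist1_ge0.
  have h : `|z ord0 i|%:~R <= n%:R :> R.
    apply: le_trans (ltW (archi_boundP b0)); apply: le_trans zb.
    by rewrite ler_int subr0 coord_le_l1.
  by rewrite -(ler_int R).
have tN i : (`|(z ord0 i + n%:Z)%R|%N < N)%N.
  by have := zi i; rewrite /N -addnn; lia.
apply/mapP; exists (\row_i Ordinal (tN i)); first by rewrite mem_enum.
apply/rowP => i; rewrite !mxE /=.
have : z ord0 i = (`|(z ord0 i + n%:Z)%R|%N)%:Z - n%:Z by have := zi i; lia.
exact.
Qed.

Lemma delone_ball_finite (R : realType) (d : nat) (X : set 'rV[R]_d)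
    (x0 : 'rV[R]_d) (b : R) : delone X ->
  exists s : seq 'rV[R]_d, uniq s /\
    forall x, (x \in s) <-> (X x /\ l1 (x - x0) <= b).
Proof.
move=> Xd.
pose A := [set x | l1 (x - x0) <= b].
have fA : finite_set (X `&` A).
  apply: sub_finite_set (finite_box Xd (x0 - const_mx b) (x0 + const_mx (b +
    1))).
  move=> x [Xx xb]; split=> // i; have := le_trans (coord_le_l1 _ i) xb.
  by rewrite !mxE ler_norml => /andP[? ?]; apply/andP; split; lra.
exists (enum_fset (fset_set (X `&` A))); split; first exact: fset_uniq.
by move=> x; split; [rewrite in_fset_set// inE|move=> h;
  rewrite in_fset_set// inE].
Qed.

Lemma quasi_isometric_bijection (R : realType) (d' : nat)
    (X : set 'rV[R]_d'.+1) : delone X -> linearly_repetitive X ->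
  exists (K C : R) (h : 'rV[R]_d'.+1 -> 'rV[int]_d'.+1)
      (k : 'rV[int]_d'.+1 -> 'rV[R]_d'.+1),
    [/\ 0 < K, 0 <= C,
        forall x, X x -> k (h x) = x, forall z, X (k z) /\ h (k z) = z &
        forall x x', X x -> X x' ->
          dist1 R (h x) (h x') <= K * l1 (x - x') + C /\
          l1 (x - x') <= K * dist1 R (h x) (h x') + C].
Proof.
move=> Xd Xlr.
have [x0 Xx0] : exists x0, X x0.
  by have [_ [_ [_ _ /(_ 0)[x0 [Xx0 _]] _]]] := Xd; exists x0.
have [K [C [K0 C0 H]]] := window_relation Xd Xlr Xx0.
have {H} H : forall W : nat, exists S : 'rV[R]_d'.+1 -> 'rV[int]_d'.+1 -> Prop,
    [/\ exists2 m : R, 0 < m & transport S (fun x => m * (`[< X x >])%:R)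
      (fun=> m),
      S x0 0, forall x z, S x z -> X x &
      forall x z x' z', S x z -> S x' z' -> l1 (x' - x0) <= W%:R ->
        dist1 R z z' <= K * l1 (x - x') + C /\ l1 (x - x') <= K * dist1 R z z'
          + C].
  by move=> W; have [m [S [m0 tS S0 SX SW]]] := H W%:R; exists S; split=> //;
    exists m.
have [S HS] := choice H.
have base W x z : S W x z ->
    dist1 R z 0 <= K * l1 (x - x0) + C /\ l1 (x - x0) <= K * dist1 R z 0 + C.
  have [_ S0 _ SW] := HS W => xz; apply: SW => //.
  by rewrite /l1 big1// => i _; rewrite subrr mxE normr0.
(* Points of [X] and lattice points carry the same mass [m], so the weighted condition reduces to
   Hall's condition on cardinalities. *)
have alphaE W : exists a : 'rV[R]_d'.+1 -> 'rV[int]_d'.+1,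
    (forall x, X x -> l1 (x - x0) <= W%:R -> S W x (a x)) /\
    (forall x y, X x -> X y -> l1 (x - x0) <= W%:R -> l1 (y - x0) <= W%:R ->
       a x = a y -> x = y).
  have [s [us hs]] := delone_ball_finite x0 W%:R Xd.
  have [[m m0 [fin _ dom _]] _ SX _] := HS W.
  have [|f [finj fS]] := hall_seq 0 us fin.
    move=> A' B uA uB A's A'B; have := dom A' B uA uB A'B.
    rewrite big_seq (eq_bigr (fun=> m)) => [|x /A's/hs[Xx _]]; last first.
      by rewrite asboolT// mulr1.
    rewrite -big_seq !big_const_seq !count_predT !iter_addr_0.
    by rewrite ler_pMn2l.
  exists f; split=> [x Xx xW|x y Xx Xy xW yW].
    by apply: fS; apply/hs.
  by apply: finj; apply/hs.
have betaE W : exists b : 'rV[int]_d'.+1 -> 'rV[R]_d'.+1,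
    (forall z, dist1 R z 0 <= W%:R -> S W (b z) z) /\
    (forall z z', dist1 R z 0 <= W%:R -> dist1 R z' 0 <= W%:R ->
       b z = b z' -> z = z').
  have [s hs] := @int_ball_finite R d'.+1 W%:R.
  have [[m m0 [_ fin _ dom]] _ SX _] := HS W.
  have [|f [finj fS]] := @hall_seq _ _ x0 (fun z x => S W x z) (undup s)
    (undup_uniq s) fin.
    move=> A' B uA uB A's A'B; have := dom A' B uA uB A'B.
    have hB : \sum_(x <- B) m * (`[< X x >])%:R <= \sum_(x <- B) m.
      by apply: ler_sum => x _; case: asboolP => _; rewrite ?mulr1 ?mulr0// ltW.
    move=> /le_trans/(_ hB).
    rewrite !big_const_seq !count_predT !iter_addr_0.
    by rewrite ler_pMn2l.
  exists f; split=> [z zW|z z' zW zW'].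
    by apply: fS; rewrite mem_undup; apply: hs.
  by apply: finj; rewrite mem_undup; apply: hs.
have [al hal] := choice alphaE; have [be hbe] := choice betaE.
have [F [FU FF]] := @ultraFilterLemma nat \oo _.
have large (b : R) : F [set W | b <= W%:R].
  apply: FF; exists (Num.bound `|b|) => // W /= bW.
  apply: le_trans (ler_norm b) _; apply: ltW.
  by apply: lt_le_trans (archi_boundP (normr_ge0 b)) _; rewrite ler_nat.
(* By [base] the images of [x] stay in a ball independent of [W], so the ultrafilter selects one of
   them. *)
have alim x : exists z, X x -> F [set W | al W x = z].
  have [Xx|nX] := pselect (X x); last by exists 0.
  have [s hs] := @int_ball_finite R d'.+1 (K * l1 (x - x0) + C).
  have [|z [_ Fz]] := @ultra_finite_const _ F s (fun W => al W x) FU.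
    apply: filterS (large (l1 (x - x0))) => W /= xW; apply: hs.
    by have [/(_ x Xx xW)/base[]] := hal W.
  by exists z.
have blim z : exists x, F [set W | be W z = x].
  have [s [_ hs]] := delone_ball_finite x0 (K * dist1 R z 0 + C) Xd.
  have [|x [_ Fx]] := @ultra_finite_const _ F s (fun W => be W z) FU.
    apply: filterS (large (dist1 R z 0)) => W /= zW; apply/hs.
    have [/(_ z zW) bz _] := hbe W; have [_ _ SX _] := HS W.
    by split; [exact: SX bz|have [] := base _ _ _ bz].
  by exists x.
have [a ha] := choice alim; have [b hb] := choice blim.
(* Two pairs in [Slim] are related for a common, arbitrarily large [W], so [Slim] satisfies the
   estimates without a window. *)
pose Slim x z := F [set W | S W x z].
have FP : ProperFilter F by exact: ultra_proper.
have aS x : X x -> Slim x (a x).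
  move=> Xx;
    apply: filterS (filterI (ha x Xx) (large (l1 (x - x0)))) => W /= [<- xW].
  by have [/(_ x Xx xW)] := hal W.
have bS z : X (b z) /\ Slim (b z) z.
  have G : F [set W | X (b z) /\ S W (b z) z].
    apply: filterS (filterI (hb z) (large (dist1 R z 0))) => W /= [<- zW].
    have [/(_ z zW) bz _] := hbe W; have [_ _ SX _] := HS W.
    by split=> //; exact: SX bz.
  split; first by have [W []] := filter_ex G.
  by apply: filterS G => W [].
have ainj x y : X x -> X y -> a x = a y -> x = y.
  move=> Xx Xy axy; have := ha y Xy; rewrite -axy => hay.
  have [W /= [[wx wy] [xW yW]]] := filter_ex (filterI (filterI (ha x Xx) hay)
    (filterI (large (l1 (x - x0))) (large (l1 (y - x0))))).
  by have [_] := hal W; apply=> //; rewrite wx wy.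
have binj z z' : b z = b z' -> z = z'.
  move=> bzz; have := hb z'; rewrite -bzz => hbz.
  have [W /= [[wx wy] [xW yW]]] := filter_ex (filterI (filterI (hb z) hbz)
    (filterI (large (dist1 R z 0)) (large (dist1 R z' 0)))).
  by have [_] := hbe W; apply=> //; rewrite wx wy.
have [h [k [hA hB]]] := @schroeder_bernstein_rel _ _ Slim X setT a b
  (fun x Xx => conj I (aS x Xx)) ainj (fun z _ => bS z) (fun z z' _ _ => @binj
    z z').
exists K, C, h, k; split=> //.
- by move=> x /hA[].
- by move=> z; exact: hB.
move=> x x' Xx Xx'; have [_ Sx _] := hA x Xx; have [_ Sx' _] := hA x' Xx'.
have [W /= [[wx wx'] x'W]] := filter_ex (filterI (filterI Sx Sx') (large (l1
  (x' - x0)))).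
by have [_ _ _] := HS W; apply.
Qed.

Unset Implicit Arguments.

Theorem theorem2p1 (R : realType) (d : nat) (d_ge2 : (2 <= d)%N)
  (X : set 'rV[R]_d) (X_delone : delone X)
  (X_lr : linearly_repetitive X) :
  bilipschitz_equivalent X (@integer_lattice R d).
Proof.
case: d d_ge2 X X_delone X_lr => [//|d'] _ X Xd Xlr.
have [K [C [h [k [K0 C0 kh hk qi]]]]] := quasi_isometric_bijection Xd Xlr.
have [r [r0 sep]] := delone_separated Xd.
pose D : R := d'.+1%:R; pose del := D * (2 * r).
have D0 : 0 < D by rewrite ltr0n.
have del0 : 0 < del by rewrite !mulr_gt0.
pose emb (z : 'rV[int]_d'.+1) : 'rV[R]_d'.+1 := map_mx intr z.
pose fl (y : 'rV[R]_d'.+1) : 'rV[int]_d'.+1 := map_mx Num.floor y.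
have flK z : fl (emb z) = z by apply/rowP => i; rewrite !mxE intrKfloor.
have embK y : integer_lattice y -> emb (fl y) = y.
  by move=> hy; apply/rowP => i; rewrite !mxE floorK.
have embZ z : integer_lattice (emb z) by move=> i; rewrite mxE intr_int.
have l1emb z z' : l1 (emb z - emb z') = dist1 R z z'.
  rewrite /dist1 /l1 rmorph_sum; apply: eq_bigr => i _.
  by rewrite /= !mxE -intrB intr_norm.
have dist_ge1 (z z' : 'rV[int]_d'.+1) : z != z' -> 1 <= dist1 R z z'.
  move=> zz'; rewrite -[1]/(1%:~R) ler_int -gtz0_ge1 lt_neqAle l1_ge0 andbT.
  apply: contra zz' => /eqP e; apply/eqP/rowP => i.
  have := coord_le_l1 (z - z') i; rewrite -e normr_le0 !mxE subr_eq0.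
  by move/eqP.
(* Distinct points are at [l1] distance at least [del] in [X] and at least 1 in the lattice, so the
   additive [C] is absorbed as [C / del] and as [C]. The factors [D] compare the [l1] norm with the
   Euclidean one. *)
exists (fun x => emb (h x)), (D * (K + C / del) + D * (K + C)).
have c1 : 0 < K + C / del by rewrite ltr_wpDr// divr_ge0// ltW.
have c2 : 0 < K + C by rewrite ltr_wpDr.
have Kpos : 0 < D * (K + C / del) + D * (K + C) by rewrite addr_gt0// mulr_gt0.
split=> //.
  exists (fun y => k (fl y)); split.
  - by move=> x Xx; rewrite flK (kh x Xx).
  - by move=> y yZ; have [Xk hkf] := hk (fl y); rewrite hkf embK.
  - exact: (@separated_within_continuous _ _ _ (2 * r)) (mulr_gt0 _ r0) sep.
  (* The separation to check is then [D * (2 * D)^-1], that is 1 / 2, below the minimal distance 1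
     of lattice points. *)
  - apply: (@separated_within_continuous _ _ _ (2 * D)^-1).
      by rewrite invr_gt0 mulr_gt0.
    move=> y y' yZ yZ' yy'; rewrite -(embK y yZ) -(embK y' yZ').
    congr emb; apply/eqP/negPn/negP => /dist_ge1.
    rewrite -l1emb !embK// leNgt => /negP; apply.
    apply: le_lt_trans yy' _; rewrite -/D invfM mulrCA mulfV ?gt_eqF//.
    by rewrite mulr1 invf_lt1// ltr1n.
move=> x x' Xx Xx'.
have e0 (u : 'rV[R]_d'.+1) : 0 <= enorm u by exact: sqrtr_ge0.
have [->|xx'] := eqVneq x x'.
  have z0 : enorm (0 : 'rV[R]_d'.+1) = 0.
    apply/eqP; rewrite eq_le e0 andbT; apply: le_trans (enorm_le_l1 _) _.
    by rewrite /l1 big1// => i _; rewrite mxE normr0.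
  by rewrite !subrr z0 !mulr0.
have [q1 q2] := qi x x' Xx Xx'.
have hne : h x != h x'.
  by apply: contra xx' => /eqP e; rewrite -(kh x Xx) e (kh x' Xx').
have dz := dist_ge1 _ _ hne.
have lx : del <= l1 (x - x').
  rewrite leNgt; apply/negP => lt; move/eqP: xx'; apply.
  by apply: sep => //; apply: ltW.
have n1 := enorm_le_l1 (x - x'); have n2 := l1_le_enorm (x - x').
have n3 := enorm_le_l1 (emb (h x) - emb (h x')).
have n4 := l1_le_enorm (emb (h x) - emb (h x')).
rewrite -/D l1emb in n2 n3 n4.
have ub : enorm (emb (h x) - emb (h x')) <= D * (K + C / del) * enorm (x - x').
  apply: le_trans n3 _; apply: le_trans q1 _.
  apply: (@le_trans _ _ ((K + C / del) * l1 (x - x'))).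
    rewrite mulrDl lerD2l -mulrA ler_peMr// mulrC ler_pdivlMr// mul1r.
    by [].
  by rewrite mulrAC [leRHS]mulrC ler_pM2l// mulrC.
have lb : enorm (x - x') <= D * (K + C) * enorm (emb (h x) - emb (h x')).
  apply: le_trans n1 _; apply: le_trans q2 _.
  apply: (@le_trans _ _ ((K + C) * dist1 R (h x) (h x'))).
    by rewrite mulrDl lerD2l ler_peMr.
  by rewrite mulrAC [leRHS]mulrC ler_pM2l// mulrC.
split.
  rewrite ler_pdivrMl//; apply: le_trans lb _; rewrite ler_wpM2r//.
  by rewrite lerDr mulr_ge0// ltW.
apply: le_trans ub _; rewrite ler_wpM2r//.
by rewrite lerDl mulr_ge0// ltW.
Qed.
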